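(* There exists a polyhedral platypus of order $n$ for every integer $n \ge 21$.
   Context: Graphs are finite and simple, with at least three vertices. A graph is hamiltonian (traceable) if it contains a spanning cycle (spanning path). A platypus is a non-hamiltonian graph $G$ such that for every vertex $v$ of $G$ the vertex-deleted subgraph $G-v$ is traceable. A graph is polyhedral if it is planar and $3$-connected. The order of a graph is its number of vertices. *)

(* Defs.v *)
From HB Require Import structures.
From mathcomp Require Import all_boot all_order all_algebra.
From mathcomp Require Import all_classical all_reals all_analysis.

Set Implicit Arguments.
Unset Strict Implicit.
Unset Printing Implicit Defensive.

Import Order.TTheory GRing.Theory Num.Theory.
Import numFieldNormedType.Exports.

(* A finite simple graph; its order is #|vertex G|. *)
Record sgraph := SGraph {
  vertex :> finType;
  edge : rel vertex;
  edge_sym : symmetric edge;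
  edge_irrefl : irreflexive edge }.

Section Subgraphs.
Variable G : sgraph.

Section Induced.
Variable A : {set G}.

Definition induced_edge : rel {x : G | x \in A} :=
  [rel x y | edge (val x) (val y)].

Lemma induced_edge_sym : symmetric induced_edge.
Proof. by move=> x y; exact: edge_sym. Qed.

Lemma induced_edge_irrefl : irreflexive induced_edge.
Proof. by move=> x; exact: edge_irrefl. Qed.

Definition induced : sgraph := SGraph induced_edge_sym induced_edge_irrefl.

End Induced.

Definition del_vertices (S : {set G}) : sgraph := induced (~: S)%SET.

Definition del_vertex (v : G) : sgraph := del_vertices [set v]%SET.

End Subgraphs.

(* Without the bound on the size, a single edge x y would yield the closed
   walk [:: x; y]. *)
Definition hamiltonian (G : sgraph) : Prop :=
  exists c : seq G,
    [/\ 2 < size c, path.cycle (@edge G) c, uniq c & forall v : G, v \in c].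

Definition traceable (G : sgraph) : Prop :=
  exists (x : G) (p : seq G),
    [/\ path (@edge G) x p, uniq (x :: p) & forall v : G, v \in x :: p].

Definition platypus (G : sgraph) : Prop :=
  [/\ 3 <= #|G|, ~ hamiltonian G & forall v : G, traceable (del_vertex v)].

Definition connected_graph (G : sgraph) : Prop :=
  0 < #|G| /\ forall x y : G, connect (@edge G) x y.

Definition k_connected (k : nat) (G : sgraph) : Prop :=
  k < #|G| /\
  forall S : {set G}, #|S| < k -> connected_graph (del_vertices S).

Section Planarity.
Local Open Scope classical_set_scope.
Local Open Scope ring_scope.
Variable R : realType.

(* A is a simple arc in the plane with ends a and b. *)
Definition is_arc (A : set (R * R)) (a b : R * R) : Prop :=
  exists f : R -> R * R,
    [/\ {within `[0, 1], continuous f},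
        {in `[0, 1] &, injective f},
        f 0 = a, f 1 = b & f @` `[0, 1] = A].

(* The edge with ends x and y is the set [set x; y], so that arc assigns one
   curve to each unordered pair; its values at non-edges are irrelevant. *)
Definition plane_drawing (G : sgraph)
    (pt : G -> R * R) (arc : {set G} -> set (R * R)) : Prop :=
  [/\ injective pt,
      forall x y : G, edge x y -> is_arc (arc [set x; y]%SET) (pt x) (pt y),
      forall x y z : G, edge x y ->
        arc [set x; y]%SET (pt z) -> z = x \/ z = y
    & forall x y x' y' : G, edge x y -> edge x' y' ->
        [set x; y]%SET <> [set x'; y']%SET ->
        arc [set x; y]%SET `&` arc [set x'; y']%SET `<=`
        pt @` [set z | z \in [set x; y]%SET :&: [set x'; y']%SET] ].

Definition planar (G : sgraph) : Prop :=
  exists (pt : G -> R * R) (arc : {set G} -> set (R * R)),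
    plane_drawing pt arc.

Definition polyhedral (G : sgraph) : Prop := planar G /\ k_connected 3 G.

End Planarity.

(* Main.v *)
Require Import Defs.
From HB Require Import structures.
From mathcomp Require Import all_boot all_order all_algebra.
From mathcomp Require Import all_classical all_reals all_analysis.
From mathcomp Require Import zify ring lra.

(* A polyhedral platypus on 21 vertices has a cubic vertex h lying in a
   triangle h t1 t2. Replacing the edge t1 t2 by a path t1 u_1 ... u_k t2 all of
   whose inner vertices are joined to h yields a fan, and every order n >= 21
   arises with k = n - 21. A hamiltonian cycle of the fan visits h and the u_j
   in at most two stretches, and contracting these leaves a hamiltonian cycle of
   the core, which exhaustive search excludes. Hamiltonian paths of the core
   minus a vertex that can be cut open along the triangle extend over the u_j;
   a hamiltonian path of the core through t1 h t2 handles the deletion of some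
   u_j. The u_j are drawn on the segment t1 t2 of a straight-line drawing of the
   core, in which a separating line certifies that two edges do not cross. *)

Set Implicit Arguments.
Unset Strict Implicit.
Unset Printing Implicit Defensive.

(** * The fan over a core graph *)

(** Contraction works because t1 and t2 are neighbours of h: every edge that leaves {h, u_1, ...,
    u_k} ends at a neighbour of h in the core, so a stretch through h shrinks to h, and a stretch
    avoiding h shrinks to the edge t1 t2. 3-connectedness is reduced to the core too. If two core
    vertices are deleted, the intact path of the u_j does the work of the edge t1 t2; if some u_j is
    deleted and h survives, the detour t1 h t2 does; if h and some u_j are deleted, the core minus h
    must be connected even without t1 t2. As k is unbounded, only facts about the core can be
    evaluated. They are booleans over lists of naturals, and graphs stay relations on [nat] until
    the end. The vertex t1 is numbered last in the core, as c - 1, so that t1, u_1, ..., u_k are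
    consecutive numbers, with u_j = c + j - 1. *)

Lemma split_first (T : eqType) (p : pred T) (s : seq T) :
  has p s -> exists s1 y s2, [/\ s = s1 ++ y :: s2, ~~ has p s1 & p y].
Proof.
elim: s => [//|x s IHs] /=; case px: (p x) => /=.
  by move=> _; exists [::], x, s.
by case/IHs => s1 [y [s2 [-> ? ?]]]; exists (x :: s1), y, s2; split=> //=; rewrite px.
Qed.

Lemma split_last (T : eqType) (p : pred T) (s : seq T) :
  has p s -> exists s1 y s2, [/\ s = rcons s1 y ++ s2, p y & ~~ has p s2].
Proof.
rewrite -has_rev => /split_first [s1 [y [s2 [def_s s1p py]]]].
exists (rev s2), y, (rev s1); split=> //; last by rewrite has_rev.
by rewrite -[s]revK def_s rev_cat rev_cons.
Qed.

Lemma sorted_cat_nil (e : rel nat) (s1 s2 : seq nat) :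
  sorted e (s1 ++ s2) =
    [&& sorted e s1, sorted e s2 & [|| nilp s1, nilp s2 | e (last 0 s1) (head 0 s2)]].
Proof.
case: s1 => [|x s1] /=; first by rewrite andbT.
rewrite cat_path; case: s2 => [|y s2] //=; by rewrite [e _ _ && _]andbC.
Qed.

Lemma last_iota (x i m : nat) : last x (iota i m.+1) = i + m.
Proof. by rewrite -[m.+1]addn1 iotaD last_cat. Qed.

(** * Certified connectivity on lists of naturals *)

Section Connectivity.

Variables (e : rel nat) (V : seq nat).

Definition closed_on (C : nat -> Prop) : Prop :=
  forall i j, i \in V -> j \in V -> C i -> e i j -> C j.

(** Reachability from [r] as an induction principle over arbitrary predicates. A predicate closed in
    the fan can then be fed to the principle of the core, and no walk is ever transformed. *)
Definition conn_on : Prop :=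
  exists2 r, r \in V & forall C, C r -> closed_on C -> forall i, i \in V -> C i.

Variable tab : seq (seq nat).
Hypothesis tabP : forall i j, j \in nth [::] tab i -> e i j.

Fixpoint reach (m : nat) (front todo : seq nat) : bool :=
  if m is m'.+1 then
    if front is v :: front' then
      let new := [seq u <- nth [::] tab v | u \in todo] in
      reach m' (new ++ front') [seq u <- todo | u \notin new]
    else nilp todo
  else nilp todo.

Definition conn_check : bool :=
  if V is r :: V' then reach (size V) [:: r] V' else false.

Lemma conn_checkP : conn_check -> conn_on.
Proof.
rewrite /conn_check; case def_V: {1}V => [//|r V'] reachV.
have rV : r \in V by rewrite def_V mem_head.
exists r => // C Cr clC.
have reachP m front todo : reach m front todo ->
    (forall i, i \in front -> i \in V /\ C i) -> {subset todo <= V} ->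
    forall i, i \in todo -> C i.
  elim: m front todo => [|m IHm] front todo /=; first by case: todo.
  case: front => [|v front]; first by case: todo.
  set new := [seq _ <- _ | _] => re frontC todoV i itodo.
  have newC u : u \in new -> u \in V /\ C u.
    rewrite mem_filter => /andP[ut uv]; have [vV Cv] := frontC v (mem_head _ _).
    by split; [exact: todoV|exact: clC vV (todoV _ ut) Cv (tabP uv)].
  have [inew|inew] := boolP (i \in new); first by have [] := newC i inew.
  apply: (IHm _ _ re); last by rewrite mem_filter inew.
    move=> u; rewrite mem_cat => /orP[/newC//|uf].
    by apply: frontC; rewrite inE uf orbT.
  by move=> u; rewrite mem_filter => /andP[_ /todoV].
move=> i; rewrite def_V inE => /orP[/eqP -> //|iV'].
apply: reachP reachV _ _ i iV' => [u|u uV']; first by rewrite inE => /eqP ->.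
by rewrite def_V inE uV' orbT.
Qed.

End Connectivity.

Definition adj_table (c : nat) (e : rel nat) : seq (seq nat) :=
  [seq [seq j <- iota 0 c | e i j] | i <- iota 0 c].

Lemma mem_adj_table (c : nat) (e : rel nat) (i j : nat) :
  (j \in nth [::] (adj_table c e) i) = [&& i < c, j < c & e i j].
Proof.
have [ic|ci] := ltnP i c; last by rewrite nth_default // size_map size_iota.
by rewrite (nth_map 0) ?size_iota // nth_iota // mem_filter mem_iota add0n andbC.
Qed.

(** * The fan and its edges *)

Section Fan.

Variables (c h t2 : nat) (E : seq (nat * nat)).

Definition base : rel nat := [rel i j | ((i, j) \in E) || ((j, i) \in E)].

Let t1 := c.-1.

(* The triangle h, c.-1, t2 of the graph for k = 0 is subdivided: the path
   c.-1, c, ..., c + k - 1, t2 replaces its edge opposite to h. *)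
Definition fan_half (k : nat) : rel nat := [rel i j |
  [|| (i == h) && (c <= j < c + k),
      [&& c.-1 <= i, j == i.+1 & j < c + k]
    | (i == (c + k).-1) && (j == t2)]].

Definition fan (k : nat) : rel nat :=
  [rel i j | base i j || (fan_half k i j || fan_half k j i)].

Definition base_ok : bool :=
  [&& all (fun e => [&& e.1 < c, e.2 < c & e.1 != e.2]) E, h < c.-1, t2 < c.-1,
      h != t2, base h c.-1 & base h t2].

Hypothesis ok : base_ok.

Lemma base_lt i j : base i j -> [&& i < c, j < c & i != j].
Proof.
case/and5P: ok => /allP E_ok _ _ _ _ /orP[] /E_ok /=; first by [].
by case/and3P=> -> ->; rewrite eq_sym.
Qed.

Lemma base_sym : symmetric base.
Proof. by move=> i j; apply: orbC. Qed.

Lemma fan_sym k : symmetric (fan k).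
Proof.
move=> i j; rewrite /fan [LHS]/= [RHS]/= [X in _ || X]orbC.
by congr (_ || _); apply: orbC.
Qed.

Lemma hlt : h < c.-1. Proof. by case/and5P: ok. Qed.
Lemma t2lt : t2 < c.-1. Proof. by case/and5P: ok. Qed.
Lemma ht2 : h != t2. Proof. by case/and5P: ok. Qed.
Lemma base_ht1 : base h c.-1. Proof. by case/and5P: ok => _ _ _ _ /andP[]. Qed.
Lemma base_ht2 : base h t2. Proof. by case/and5P: ok => _ _ _ _ /andP[]. Qed.

Lemma fan_irrefl k : irreflexive (fan k).
Proof.
move=> i; have := hlt; have := t2lt => *.
apply/negP => /orP[/base_lt|]; rewrite /fan_half /=; first lia.
case/orP=> /or3P[]; lia.
Qed.

Lemma fan_lt k i j : fan k i j -> (i < c + k) && (j < c + k).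
Proof.
have hl := hlt; have tl := t2lt.
case/orP=> [/base_lt|]; rewrite /fan_half /=; first lia.
case/orP=> /or3P[]; lia.
Qed.

(** The edges leaving the set of h and the u_j: apart from core edges at h there are only u_1 t1 and
    u_k t2, and t1, t2 are again neighbours of h. *)
Lemma fan_out k i j : 0 < k -> fan k i j -> (i == h) || (c <= i) ->
  j < c -> j != h ->
  base h j /\ (c <= i -> (i, j) = (c, c.-1) \/ (i, j) = ((c + k).-1, t2)).
Proof.
have hl := hlt; have tl := t2lt; have ht := ht2.
have bht1 := base_ht1; have bht2 := base_ht2.
move=> k_gt0 /orP[b|f0] Fi jc jh.
  have /and3P[ic _ _] := base_lt b.
  have ci : c <= i = false by lia.
  by move: Fi b; rewrite ci orbF => /eqP <-.
have {}Fi : i = h \/ c <= i by lia.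
move: f0; rewrite /fan_half /=; case/orP=> /or3P f.
- case: (boolP ((i == (c + k).-1) && (j == t2))) => [/andP[/eqP -> /eqP ->]|nf].
    by split=> // _; right.
  by exfalso; case: f => f; case: Fi; lia.
- case: (boolP ((i == c) && (j == c.-1))) => [/andP[/eqP -> /eqP ->]|nf].
    by split=> // _; left.
  by exfalso; case: f => f; case: Fi; lia.
Qed.

Lemma fan_in k i j : 0 < k -> fan k i j -> i < c -> j < c -> base i j.
Proof.
have hl := hlt; have tl := t2lt; move=> k_gt0 /orP[//|].
by rewrite /fan_half /=; case/orP=> /or3P[] f ? ?; exfalso; lia.
Qed.

Lemma fan0_base i j : base i j -> fan 0 i j.
Proof. by rewrite /fan /= => ->. Qed.

Lemma fan0_t : fan 0 c.-1 t2.
Proof. by rewrite /fan /= /fan_half /= addn0 !eqxx !orbT. Qed.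

(** * Contraction of hamiltonian cycles *)

Definition hamcycle (k : nat) (s : seq nat) : Prop :=
  [/\ 2 < size s, path.cycle (fan k) s, uniq s & s =i iota 0 (c + k)].

Lemma hamcycle_rot k s x : hamcycle k s -> x < c + k ->
  exists w, hamcycle k (x :: w).
Proof.
move=> [s2 cs us ms] xlt.
have xs : x \in s by rewrite ms mem_iota.
have [i w def_w] := rot_to xs; exists w.
by rewrite /hamcycle -def_w size_rot rot_cycle rot_uniq; split=> // y; rewrite mem_rot.
Qed.

Definition inner : pred nat := fun x => x < c.

(** The stretch through h is left at both ends towards neighbours of h, so it can be replaced by h
    alone. A stretch of u_j that avoids h can only be entered and left by u_1 t1 and u_k t2; it is
    replaced by the edge t1 t2, and it uses up both exits, so there is only one. *)
Lemma hamcycle_contract k s : hamcycle k s -> exists s', hamcycle 0 s'.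
Proof.
have [->|k_gt0] := posnP k; first by exists s.
have hl := hlt; have tl := t2lt.
have [hc t2c] : h < c /\ t2 < c by lia.
have [t1c t1h t12] : [/\ c.-1 < c, c.-1 != h & c.-1 != t2] by split; lia.
move=> /hamcycle_rot /(_ (_ : h < c + k)) [|w [sw cw uw mw]]; first by lia.
have hw : h \notin w by case/andP: uw.
have mem_w x : x < c + k -> x != h -> x \in w.
  by move=> xlt xh; have := mw x; rewrite inE (negPf xh) mem_iota /= => ->; lia.
(* With the cycle starting at h, the rest is [r1 ++ m ++ r3], where [r1] and [r3] consist of u_j and
   [m] runs from the first core vertex [a] to the last one [b]. The stretch through h is [r3], h,
   [r1]. *)
have Bw : has inner w.
  by apply/hasP; exists c.-1; rewrite /inner ?mem_w //; lia.
have [r1 [a [z [def_w r1U aB]]]] := split_first Bw.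
have {Bw}Bz : has inner (a :: z) by rewrite /= aB.
have [z1 [b [r3 [def_z bB r3U]]]] := split_last Bz.
(* If [r1] is empty, the default value [h] is the vertex from which the cycle steps to [a]; likewise
   for [r3] and [b]. *)
have r1F : (last h r1 == h) || (c <= last h r1).
  case/lastP: (r1) r1U => [|r x]; rewrite ?eqxx // last_rcons has_rcons negb_or /inner.
  by rewrite -leqNgt => /andP[-> _]; rewrite orbT.
have r3F : (head h r3 == h) || (c <= head h r3).
  case: (r3) r3U => [|x r]; rewrite /= ?eqxx // negb_or /inner.
  by rewrite -leqNgt => /andP[-> _]; rewrite orbT.
have ah : a != h.
  by apply: contraNneq hw => <-; rewrite def_w mem_cat inE eqxx orbT.
have bh : b != h.
  apply: contraNneq hw => <-.
  by rewrite def_w def_z mem_cat mem_cat mem_rcons inE eqxx !orbT.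
have [m def_m] : exists m, m = rcons z1 b by exists (rcons z1 b).
have def_w' : w = r1 ++ m ++ r3 by rewrite def_w def_z -def_m.
have lm x : last x m = b by rewrite def_m last_rcons.
have hm x : head x m = a.
  have := def_z; rewrite -def_m; case: (m) def_m => [|y m'] def_m'.
    by case: (z1) def_m'.
  by case=> ->.
move: cw; rewrite /= def_w' rcons_cat cat_path.
have -> : path (fan k) (last h r1) (rcons (m ++ r3) h) =
   [&& fan k (last h r1) a, path (fan k) a (behead m), fan k b (head h r3)
     & path (fan k) (head h r3) (behead (rcons r3 h))].
  rewrite rcons_cat; case: (m) def_m lm hm => [|y m'] def_m' lm hm.
    by case: (z1) def_m'.
  rewrite /= cat_path; have /= lmy := lm a; have /= ya := hm a.
  by rewrite lmy -ya; case: (r3).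
case/and5P=> p1 e1 pm e2 p3.
have [h_a out_a] := fan_out k_gt0 e1 r1F aB ah.
rewrite fan_sym in e2.
have [h_b out_b] := fan_out k_gt0 e2 r3F bB bh.
have uw' : uniq (r1 ++ m ++ r3) by rewrite -def_w'; case/andP: uw.
have memB x : x < c -> x != h -> x \in m.
  move=> xc xh; have := mem_w x (ltn_addr _ xc) xh.
  rewrite def_w' !mem_cat => /or3P[xr|//|xr].
    by case/hasP: r1U; exists x.
  by case/hasP: r3U; exists x.
have m_lt x : x \in m -> x < c + k.
  by move=> xm; have := mw x; rewrite inE def_w' !mem_cat xm /= !orbT mem_iota add0n /= => <-.
have hm' : h \notin m by apply: contra hw; rewrite def_w' !mem_cat => ->; rewrite orbT.
have um : uniq m by move: uw'; rewrite cat_uniq cat_uniq => /and3P[_ _ /and3P[]].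
have size_ge2 (t : seq nat) : (forall x, x < c -> x != h -> x \in t) -> 1 < size t.
  move=> t_t; apply: (@uniq_leq_size _ [:: c.-1; t2]) => [|x].
    by rewrite /= inE andbT.
  by rewrite !inE => /orP[] /eqP ->; apply: t_t; rewrite // eq_sym ht2.
have base_path x t : inner x -> all inner t -> path (fan k) x t -> path (fan 0) x t.
  elim: t x => //= y t IHt x xB /andP[yB tB] /andP[exy pyt].
  by rewrite (fan0_base (fan_in k_gt0 exy xB yB)) IHt.
have cons_m : m = a :: behead m.
  by have := hm a; case: (m) def_m => [|y m'] def_m' /= ya; [case: (z1) def_m'|rewrite ya].
have fha : fan 0 h a := fan0_base h_a.
have fbh : fan 0 b h by rewrite fan_sym; apply: fan0_base.
(* Without a second stretch, h followed by [m] is already the cycle sought. *)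
case Um: (all inner m).
  exists (h :: m); split.
  - exact/size_ge2.
  - rewrite [X in path.cycle _ (_ :: X)]cons_m /= fha rcons_path.
    rewrite base_path //=; last by move: Um; rewrite {1}cons_m => /andP[].
    by have := lm h; rewrite cons_m /= => ->.
  - by rewrite /= hm' um.
  - move=> x; rewrite inE mem_iota addn0 /=; case: eqVneq => [->|xh] /=; first by rewrite hc.
    by apply/idP/idP => [xm|xc]; [exact: (allP Um)|exact: memB].
have {Um} : has (predC inner) m by rewrite has_predC Um.
(* The second stretch is [u :: r2], from the first u_j in [m] up to the next core vertex [q]; it is
   entered from [p], the last vertex of [s1], and its own last vertex is [v]. *)
case/split_first => [s1 [u [s' [def_m1 s1B uB]]]].
have s1B' : all inner s1 by rewrite -[all _ _]negbK -has_predC.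
have s1_cons : s1 = a :: behead s1.
  move: cons_m; rewrite def_m1; case: (s1) => [[au]|y s1' [ya]] /=; last by rewrite ya.
  by move: uB; rewrite /= au aB.
have us'B : has inner s'.
  apply/hasP; exists b => //; have := lm h; rewrite def_m1 last_cat /= => lb.
  have: b \in u :: s' by rewrite -lb mem_last.
  by rewrite inE => /orP[/eqP bu|//]; move: uB; rewrite /= -bu bB.
have [r2 [q [s2 [def_s' r2B qB]]]] := split_first us'B.
rewrite {}def_s' in def_m1 => {us'B s'}.
move: (pm) (lm a); rewrite {1}cons_m in def_m1.
have : path (fan k) a (behead s1 ++ u :: r2 ++ q :: s2).
  by move: def_m1 pm; rewrite s1_cons => -[->].
rewrite cat_path /= cat_path /= => /and3P[p_s1 e3 /and3P[p_r2 e4 p_s2]] _ _.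
set p := last a (behead s1) in e3.
have p_s1' : p \in s1 by rewrite s1_cons mem_last.
have pB : inner p := allP s1B' _ p_s1'.
set v := last u r2 in e4.
have v_r2 : v \in u :: r2 := mem_last _ _.
have vB : c <= v.
  move: v_r2; rewrite inE => /orP[/eqP ->|v_r2]; first by move: uB; rewrite /= /inner -leqNgt.
  by apply: contraR r2B => vc; apply/hasP; exists v => //; rewrite /inner ltnNge.
have uB' : c <= u by move: uB; rewrite /= /inner -leqNgt.
rewrite -cons_m in def_m1.
have [p_m q_m] : p \in m /\ q \in m.
  by rewrite def_m1; split; rewrite mem_cat ?p_s1' // inE mem_cat mem_head !orbT.
have notm x : x \in m -> x != h by move=> xm; apply: contraTneq xm => ->.
have pq : p != q.
  apply: contraTneq um => pq; rewrite def_m1 cat_uniq negb_and; apply/orP; right.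
  rewrite negb_and; apply/orP; left; rewrite negbK; apply/hasP; exists p => //.
  by rewrite inE mem_cat inE pq eqxx !orbT.
rewrite fan_sym in e3.
have uF : (u == h) || (c <= u) by rewrite uB' orbT.
have vF : (v == h) || (c <= v) by rewrite vB orbT.
have [_ /(_ uB') out_p] := fan_out k_gt0 e3 uF pB (notm _ p_m).
have [_ /(_ vB) out_q] := fan_out k_gt0 e4 vF qB (notm _ q_m).
(* As [p] and [q] differ, the two ends of the stretch use different exits: [p] and [q] are t1 and
   t2, and u_1 and u_k both lie in the stretch. *)
have [fpq c_r2 n_r2] : [/\ fan 0 p q, c \in u :: r2 & (c + k).-1 \in u :: r2].
  case: out_p out_q v_r2 pq => [[-> ->]|[-> ->]] [[-> ->]|[-> ->]] v_r2 pq;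
    rewrite ?eqxx // in pq.
    by split=> //; [exact: fan0_t|rewrite mem_head].
  by split=> //; [rewrite fan_sym; exact: fan0_t|rewrite mem_head].
(* Any u_j next to a core vertex other than h on the cycle is u_1 or u_k, hence in this stretch. By
   uniqueness no u_j is left for [r1], [r3] or [s2]. *)
have edge_out i j : fan k i j -> c <= i -> j < c -> j != h -> i \in u :: r2.
  move=> e ci jc jh; have iF : (i == h) || (c <= i) by rewrite ci orbT.
  by have [_ /(_ ci) [[-> _]|[-> _]]] := fan_out k_gt0 e iF jc jh.
have r2m x : x \in u :: r2 -> x \in m.
  by rewrite def_m1 -!cat_cons !mem_cat => ->; rewrite orbT.
have r1_nil : r1 = [::].
  case/lastP: (r1) r1U r1F e1 uw' => [//|r x]; rewrite has_rcons negb_or last_rcons.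
  move=> /andP[xB _] _ e; rewrite cat_uniq has_cat !negb_or => /and3P[_ /andP[/hasP mr _] _].
  case: mr; exists x; last by rewrite mem_rcons mem_head.
  by apply/r2m/(edge_out x a) => //; move: xB; rewrite /inner -leqNgt.
have r3_nil : r3 = [::].
  case: (r3) r3U r3F e2 uw' => [//|x r] /= /norP[xB _] _ e.
  rewrite catA cat_uniq => /and3P[_ /hasP mr _]; case: mr; exists x; rewrite ?mem_head //.
  rewrite mem_cat; apply/orP; right.
  by apply/r2m/(edge_out x b) => //; move: xB; rewrite /inner -leqNgt.
have um' := um; move: um'; rewrite def_m1 cat_uniq => /and3P[us1 s1_dis].
rewrite -cat_cons cat_uniq => /and3P[ur2 r2_dis uqs2].
have qs2B : all inner (q :: s2).
  apply: contraT; rewrite -has_predC => /split_first [[|y s3] [u' [s4 [def_qs2 s3B u'B]]]].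
    by move: u'B; case: def_qs2 => <- _; rewrite /= qB.
  case: def_qs2 => def_y def_s2; rewrite -{y}def_y in s3B.
  have all3 : all inner (q :: s3) by rewrite -[all _ _]negbK -has_predC.
  move: p_s2; rewrite def_s2 cat_path /= => /and3P[_ e5 _]; rewrite fan_sym in e5.
  have l_qs3 : last q s3 \in q :: s3 := mem_last _ _.
  case/hasP: r2_dis; exists u'; first by rewrite inE def_s2 mem_cat mem_head !orbT.
  apply: (edge_out u' _ e5); first by move: u'B; rewrite /= /inner -leqNgt.
    exact: (allP all3).
  apply: notm; rewrite def_m1 -cat_cons !mem_cat def_s2.
  by apply/orP; right; apply/orP; right; rewrite -cat_cons mem_cat l_qs3.
exists (h :: s1 ++ q :: s2).
have mem_s x : x < c -> x != h -> x \in s1 ++ q :: s2.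
  move=> xc xh; have := memB x xc xh; rewrite def_m1 -cat_cons !mem_cat => /or3P[->//|xr|->].
    have [xu|xr2] : x = u \/ x \in r2 by move: xr; rewrite inE => /orP[/eqP|]; [left|right].
      by move: uB'; rewrite -xu leqNgt xc.
    by case/hasP: r2B; exists x.
  by rewrite orbT.
have sm x : x \in s1 ++ q :: s2 -> x \in m.
  by rewrite def_m1 -cat_cons !mem_cat => /orP[]->; rewrite ?orbT.
split.
- exact/size_ge2.
- rewrite s1_cons /= fha rcons_path cat_path /= fpq.
  rewrite base_path //=; last by move: s1B'; rewrite {1}s1_cons => /andP[].
  rewrite base_path //=; last by case/andP: qs2B.
  have := lm h; rewrite def_m1 last_cat /= last_cat /= last_cat /= => ->.
  by [].
- rewrite cons_uniq cat_uniq us1 uqs2 (contra (sm h) hm') !andbT !andTb.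
  apply: contra s1_dis => /hasP[x xq xs1].
  by apply/hasP; exists x => //; rewrite -cat_cons mem_cat xq orbT.
- move=> x; rewrite inE mem_iota addn0 /=; case: eqVneq => [->|xh] /=; first by rewrite hc.
  apply/idP/idP => [|xc]; last exact: mem_s.
  by rewrite mem_cat => /orP[] xs; [exact: (allP s1B')|exact: (allP qs2B)].
Qed.

(** * Hamiltonian paths of vertex-deleted fans *)

Lemma fan_iota k i m : c.-1 <= i -> i + m <= c + k -> sorted (fan k) (iota i m).
Proof.
move=> ci; elim: m i ci => [//|m IHm] i ci im /=.
case: m IHm im => [//|m] IHm im /=; apply/andP; split; last by apply: (IHm i.+1); lia.
by rewrite /fan /= /fan_half /=; apply/orP; right; apply/orP; left; lia.
Qed.

Lemma fan_h k u : c <= u < c + k -> fan k h u.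
Proof. by move=> cu; rewrite /fan /= /fan_half /= eqxx cu !orbT. Qed.

Lemma fan_last k : fan k (c + k).-1 t2.
Proof. by rewrite /fan /= /fan_half /= !eqxx !orbT. Qed.

Lemma fan_first k : 0 < k -> fan k c.-1 c.
Proof.
have hl := hlt; move=> k_gt0; rewrite /fan /= /fan_half /=.
by apply/orP; right; apply/orP; left; lia.
Qed.

(** The ends facing the gap are chosen so that u_1, ..., u_k fit in for every k: h and t1 are
    adjacent to u_1, h and t2 to u_k, and for k = 0 the gap closes by an edge of the triangle. *)
Definition trace_cert (v : nat) (s1 s2 : seq nat) : bool :=
  [&& perm_eq (v :: s1 ++ s2) (iota 0 c), sorted base s1, sorted base s2,
      nilp s1 || (last 0 s1 \in [:: h; c.-1]) & nilp s2 || (head 0 s2 \in [:: h; t2])].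

Lemma base_fan k : subrel base (fan k).
Proof. by move=> i j /= bij; rewrite /fan /= bij. Qed.

Lemma trace_base k v s1 s2 : trace_cert v s1 s2 ->
  sorted (fan k) (s1 ++ iota c k ++ s2) /\
  perm_eq (v :: s1 ++ iota c k ++ s2) (iota 0 (c + k)).
Proof.
case/and5P=> [ps b1 b2 l1 h2].
have [->|k_gt0] := posnP k.
  rewrite addn0; split=> //; rewrite sorted_cat_nil.
  rewrite (sub_sorted (@base_fan 0) b1) (sub_sorted (@base_fan 0) b2) /=.
  have := perm_uniq ps; rewrite iota_uniq cons_uniq cat_uniq => /andP[_].
  case: s1 s2 l1 h2 {ps b1 b2} => [|x s1] [|y s2] //= l1 h2 /and3P[_ s12 _].
  (* Both ends at the gap may be h according to the certificate; uniqueness of the list rules this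
     out. *)
  have {s12} : last x s1 != y.
    by apply: contra s12 => /eqP <-; rewrite mem_last.
  move: l1 h2; rewrite !inE => /orP[]/eqP -> /orP[]/eqP ->; rewrite ?eqxx // => _.
  - exact/fan0_base/base_ht2.
  - by rewrite fan_sym; apply/fan0_base/base_ht1.
  - exact: fan0_t.
have hk : nilp (iota c k) = false by case: (k) k_gt0.
have nl : nilp (iota c k ++ s2) = false by case: (k) k_gt0.
have hd : head 0 (iota c k ++ s2) = c by case: (k) k_gt0.
have lt : last 0 (iota c k) = (c + k).-1.
  by case: (k) k_gt0 => // k' _; rewrite last_iota addnS.
split; last first.
  apply/permP => p; have /permP/(_ p) := ps.
  by rewrite iotaD /= !count_cat add0n; clear; lia.
rewrite !sorted_cat_nil (sub_sorted (@base_fan k) b1) (sub_sorted (@base_fan k) b2).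
rewrite fan_iota ?leq_pred // nl hd hk lt /=; apply/andP; split.
  case/orP: h2 => [->//|]; rewrite !inE => /orP[]/eqP ->; last by rewrite fan_last orbT.
  by rewrite fan_sym fan_h ?orbT //; clear -k_gt0; lia.
case/orP: l1 => [->//|]; rewrite !inE => /orP[]/eqP ->; last by rewrite fan_first ?orbT.
by rewrite fan_h ?orbT //; clear -k_gt0; lia.
Qed.

Lemma trace_fan k j s1 s2 : j < k ->
  [&& perm_eq (h :: s1 ++ s2) (iota 0 c), sorted base s1, sorted base s2,
      (~~ nilp s1) && (last 0 s1 == c.-1) & (~~ nilp s2) && (head 0 s2 == t2)] ->
  let s := s1 ++ iota c j ++ h :: iota (c + j.+1) (k - j.+1) ++ s2 in
  sorted (fan k) s /\ perm_eq ((c + j) :: s) (iota 0 (c + k)).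
Proof.
move=> jk /and5P[ps b1 b2 /andP[n1 /eqP l1] /andP[n2 /eqP h2]] s.
have hl := hlt; have bh1 := base_ht1; have bh2 := base_ht2.
have def_k : iota c k = iota c j ++ (c + j) :: iota (c + j.+1) (k - j.+1).
  by rewrite -{1}(subnKC (ltnW jk)) iotaD -(subnSK jk) /= addnS.
split; last first.
  apply/permP => p; have /permP/(_ p) := ps.
  by rewrite iotaD def_k /s /= !count_cat /= !count_cat /=; clear; lia.
have fI1 : sorted (fan k) (iota c j) by apply: fan_iota; clear -jk; lia.
set I' := iota (c + j.+1) (k - j.+1) in s *.
have fI2 : sorted (fan k) I' by apply: fan_iota; clear -jk; lia.
have lI' : [|| nilp I', nilp s2 | fan k (last 0 I') (head 0 s2)].
  rewrite /I' h2; case: (k - j.+1) (subnKC jk) => [//|m] def_m.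
  rewrite last_iota; have -> : c + j.+1 + m = (c + k).-1 by clear -def_m; lia.
  by rewrite fan_last orbT.
have hI' : fan k h (head 0 (I' ++ s2)).
  rewrite /I'; case: (k - j.+1) (subnKC jk) => [|m] def_m /=.
    by rewrite h2 base_fan.
  by apply: fan_h; clear -def_m; lia.
have lI : nilp (iota c j) || fan k (last 0 (iota c j)) h.
  case: (j) jk => [//|m] ltm; apply/orP; right.
  by rewrite last_iota fan_sym; apply: fan_h; clear -ltm; lia.
have hI t : fan k c.-1 (head 0 (iota c j ++ h :: t)).
  case: (j) jk => [|m] ltm /=; first by rewrite fan_sym base_fan.
  by apply: fan_first; clear -ltm; lia.
rewrite /s sorted_cat_nil (sub_sorted (@base_fan k) b1) l1 hI !orbT andbT /=.
rewrite sorted_cat_nil; apply/and3P; split; [exact: fI1| |]; last first.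
  by case/orP: lI => /= ->; rewrite ?orbT.
rewrite -[h :: _]/([:: h] ++ _) sorted_cat_nil; apply/and3P; split=> //.
  by rewrite sorted_cat_nil fI2 (sub_sorted (@base_fan k) b2) lI'.
by rewrite [last _ _]/= hI' !orbT.
Qed.

(** * 3-connectedness of the fan *)

Definition conn_cert : bool :=
  let tab0 := adj_table c (fan 0) in
  [&& conn_check (iota 0 c) tab0,
      conn_check [seq i <- iota 0 c | i != h] (adj_table c base)
    & all (fun x => all (fun y =>
        conn_check [seq i <- iota 0 c | i \notin [:: x; y]] tab0) (iota 0 c)) (iota 0 c)].

(** Fewer than two deletions are covered by [x = y] or by numbers outside the graph. In each case a
    predicate closed in the fan is shown to be closed under the core edges, where only t1 t2 needs a
    detour; it then holds on the core and is spread to the u_j. *)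
Lemma fan_conn k x y : conn_cert ->
  conn_on (fan k) [seq i <- iota 0 (c + k) | i \notin [:: x; y]].
Proof.
have hl := hlt; have tl := t2lt; have bh1 := base_ht1; have bh2 := base_ht2.
have tabP (e : rel nat) i j : j \in nth [::] (adj_table c e) i -> e i j.
  by rewrite mem_adj_table => /and3P[].
have checkP e V : conn_check V (adj_table c e) -> conn_on e V.
  exact: conn_checkP (@tabP e).
move=> /and3P[/checkP conn0 /checkP connh /allP conn2].
wlog le_xy : x y / x <= y.
  move=> IH; have [/IH|/ltnW /IH IHyx] := leqP x y; first exact.
  rewrite (@eq_filter _ _ (fun i => i \notin [:: y; x])); first exact: IHyx.
  by move=> i; rewrite !inE orbC.
have c2 u v : u < c -> v < c ->
    conn_on (fan 0) [seq i <- iota 0 c | i \notin [:: u; v]].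
  move=> uc vc; have uI : u \in iota 0 c by rewrite mem_iota.
  have vI : v \in iota 0 c by rewrite mem_iota.
  exact: checkP (allP (conn2 u uI) v vI).
have [k0|k_gt0] := posnP k.
  rewrite k0 addn0; have [yc|cy] := ltnP y c.
    by apply: c2 => //; apply: leq_ltn_trans yc.
  have [xc|cx] := ltnP x c.
    rewrite (@eq_in_filter _ _ (fun i => i \notin [:: x; x])); first exact: c2.
    move=> i; rewrite mem_iota !inE orbb /= => ic.
    by rewrite negb_or (ltn_eqF (leq_trans ic cy)) andbT.
  rewrite (_ : [seq _ <- _ | _] = iota 0 c) //; apply/all_filterP/allP => i.
  rewrite mem_iota !inE /= => ic.
  by rewrite (ltn_eqF (leq_trans ic cx)) (ltn_eqF (leq_trans ic cy)).
set V := [seq _ <- _ | _].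
have inV i : (i \in V) = [&& i < c + k, i != x & i != y].
  by rewrite mem_filter mem_iota !inE negb_or andbC.
have hc : h < c by clear -hl; lia.
have t1c : c.-1 < c by clear -hl; lia.
have t1h : c.-1 != h by rewrite neq_ltn hl orbT.
have step i : c.-1 <= i -> i.+1 < c + k -> fan k i i.+1.
  by move=> ci ik; have := @fan_iota k i 2 ci; rewrite addn2 /= andbT; apply.
(* [up] spreads [C] along the path from t1, and [down] spreads it from t2, as long as no deleted
   vertex intervenes. *)
have up C i : closed_on (fan k) V C -> C c.-1 -> c.-1 \in V ->
    (forall j, c <= j <= i -> j \in V) -> c <= i -> i \in V -> C i.
  move=> clC Ct tV jV ci iV; have [m def_i] : exists m, i = c + m.
    by exists (i - c); rewrite subnKC.
  rewrite {}def_i in jV iV *; elim: m jV iV {ci} => [|m IHm] jV iV.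
    by rewrite addn0 in iV *; apply: (clC _ _ tV iV Ct (fan_first k_gt0)).
  have mV : c + m \in V by apply: jV; clear; lia.
  have Cm : C (c + m) by apply: IHm => // j jm; apply: jV; clear -jm; lia.
  apply: (clC _ _ mV iV Cm); rewrite addnS; apply: step; first by clear; lia.
  by move: iV; rewrite inV addnS => /and3P[].
have down C i : closed_on (fan k) V C -> C t2 -> t2 \in V ->
    (forall j, i <= j < c + k -> j \in V) -> c <= i -> i \in V -> C i.
  move=> clC Ct tV jV ci iV; have ik : i < c + k by move: iV; rewrite inV => /and3P[].
  have [m def_m] : exists m, i + m = (c + k).-1.
    by exists ((c + k).-1 - i); clear -ik; lia.
  elim: m i def_m jV ci ik {iV} => [|m IHm] i def_m jV ci ik.
    have iV : i \in V by apply: jV; rewrite leqnn ik.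
    have fti : fan k t2 i by rewrite fan_sym -[i]addn0 def_m fan_last.
    exact: (clC _ _ tV iV Ct fti).
  have i1V : i.+1 \in V by apply: jV; clear -def_m; lia.
  have iV : i \in V by apply: jV; rewrite leqnn ik.
  have Ci : C i.+1.
    apply: IHm; [clear -def_m; lia| |clear -ci; lia|clear -def_m; lia].
    by move=> j jc; apply: jV; clear -jc; lia.
  have fi : fan k i.+1 i by rewrite fan_sym; apply: step; clear -def_m ci; lia.
  exact: (clC _ _ i1V iV Ci fi).
have fromh C : closed_on (fan k) V C -> C h -> h \in V ->
    forall i, c <= i -> i \in V -> C i.
  move=> clC Ch hV i ci iV; apply: (clC _ _ hV iV Ch); apply: fan_h.
  by rewrite ci; move: iV; rewrite inV => /and3P[].
have fan0E i j : fan 0 i j -> [\/ base i j, i = c.-1 /\ j = t2 | i = t2 /\ j = c.-1].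
  case/orP=> [b|]; first by constructor 1.
  rewrite /fan_half /= addn0; case/orP=> /or3P[] f; try (exfalso; clear -f hl; lia).
    by constructor 2; case/andP: f => /eqP -> /eqP ->.
  by constructor 3; case/andP: f => /eqP -> /eqP ->.
(* If both deleted numbers are core vertices, the whole path survives and replaces the edge t1 t2 in
   either direction. *)
have [yc|cy] := ltnP y c.
  have UV i : c <= i < c + k -> i \in V by rewrite inV; clear -yc le_xy; lia.
  have xc : x < c by exact: leq_ltn_trans yc.
  have inV0 i : (i \in [seq i <- iota 0 c | i \notin [:: x; y]]) = (i < c) && (i \in V).
    by rewrite inV mem_filter mem_iota !inE negb_or; clear; lia.
  case: (c2 x y xc yc) => r; rewrite inV0 => /andP[rc rV] Cr.
  exists r => // C C_r clC.
  have cV : c \in V by apply: UV; clear -k_gt0; lia.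
  have lV : (c + k).-1 \in V by apply: UV; clear -k_gt0; lia.
  have C0 i : i \in V -> i < c -> C i.
    move=> iV ic; apply: (Cr C C_r); last by rewrite inV0 ic iV.
    move=> a b; rewrite !inV0 => /andP[ac aV] /andP[bc bV] Ca.
    case/fan0E=> [bab|[def_a def_b]|[def_a def_b]].
    - exact: (clC _ _ aV bV Ca (@base_fan k _ _ bab)).
    - rewrite def_a def_b in Ca aV bV *; apply: (clC _ _ lV bV _ (fan_last k)).
      by apply: up => // [j jc|]; [apply: UV; clear -jc k_gt0; lia|clear -k_gt0; lia].
    - rewrite def_a def_b in Ca aV bV *.
      have fc : fan k c c.-1 by rewrite fan_sym fan_first.
      apply: (clC _ _ cV bV _ fc).
      by apply: down.
  move=> i iV; have [ic|ci] := ltnP i c; first exact: C0.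
  have ik : i < c + k by move: iV; rewrite inV => /and3P[].
  have [hV|hV] := boolP (h \in V); first by apply: fromh => //; apply: C0.
  have [tV|tV] := boolP (c.-1 \in V).
    apply: up => //; first exact: C0.
    by move=> j jc; apply: UV; clear -jc ik; lia.
  (* The two deleted vertices are h and t1 here. *)
  have t2V : t2 \in V.
    by move: hV tV (ht2); rewrite !inV; clear -hl tl; lia.
  apply: down => //; first by apply: C0 => //; clear -tl; lia.
  by move=> j jc; apply: UV; clear -jc ci; lia.
have hy : h != y by rewrite neq_ltn (leq_trans hc cy).
(* With h deleted, the path may be cut at [y]: the part below [y] hangs on t1, the part above on t2,
   and t1 t2 has no substitute, so the check is the one on [base]. *)
have [xh|xh] := eqVneq x h.
  have inVh i : (i \in [seq i <- iota 0 c | i != h]) = (i < c) && (i \in V).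
    by rewrite inV xh mem_filter mem_iota; clear -cy; lia.
  case: connh => r; rewrite inVh => /andP[rc rV] Cr.
  exists r => // C C_r clC.
  have C0 i : i \in V -> i < c -> C i.
    move=> iV ic; apply: (Cr C C_r); last by rewrite inVh ic iV.
    move=> a b; rewrite !inVh => /andP[ac aV] /andP[bc bV] Ca bab.
    exact: (clC _ _ aV bV Ca (@base_fan k _ _ bab)).
  have tV : c.-1 \in V by rewrite inV xh t1h; clear -t1c cy; lia.
  have t2V : t2 \in V by move: (ht2); rewrite inV xh; clear -tl cy; lia.
  move=> i iV; have [ic|ci] := ltnP i c; first exact: C0.
  have iy' : i != y by move: iV; rewrite inV => /and3P[].
  have ik : i < c + k by move: iV; rewrite inV => /and3P[].
  have [iy|yi] := ltnP i y.
    apply: up => //; first exact: C0.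
    by move=> j jc; rewrite inV xh; clear -jc iy ik hc; lia.
  apply: down => //; first by apply: C0 => //; clear -tl; lia.
  by move=> j jc; rewrite inV xh; clear -jc yi iy' ci hc; lia.
have hV : h \in V by rewrite inV hy eq_sym xh; clear -hc; lia.
(* Now h survives and the core loses at most [x], which need not be a core vertex either. The detour
   t1 h t2 replaces t1 t2, and h reaches every surviving u_j. *)
have [r [rc rx Cr]] : exists r, [/\ r < c, r != x & forall C : nat -> Prop, C r ->
    (forall i j, i < c -> j < c -> i != x -> j != x -> C i -> fan 0 i j -> C j) ->
    forall i, i < c -> i != x -> C i].
  have [xc|cx] := ltnP x c.
    have mV0 i : (i \in [seq i <- iota 0 c | i \notin [:: x; x]]) = (i < c) && (i != x).
      by rewrite mem_filter mem_iota !inE orbb andbC.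
    case: (c2 x x xc xc) => r; rewrite mV0 => /andP[rc rx] Cr; exists r; split=> //.
    move=> C C_r clC i ic ix; apply: (Cr C C_r); last by rewrite mV0 ic.
    by move=> a b; rewrite !mV0 => /andP[ac ax] /andP[bc bx]; apply: clC.
  have ltx i : i < c -> i != x by move=> ic; rewrite neq_ltn (leq_trans ic cx).
  case: conn0 => r; rewrite mem_iota => /= rc Cr; exists r; split=> //; first exact: ltx.
  move=> C C_r clC i ic ix; apply: (Cr C C_r); last by rewrite mem_iota.
  by move=> a b; rewrite !mem_iota => /= ac bc; apply: clC => //; apply: ltx.
have inVc i : i < c -> i != x -> i \in V by rewrite inV => ic ->; clear -ic cy; lia.
exists r; first exact: inVc.
move=> C C_r clC.
have C0 i : i < c -> i != x -> C i.
  move=> ic ix; apply: (Cr C C_r) => // a b ac bc ax bx Ca.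
  have aV := inVc _ ac ax; have bV := inVc _ bc bx.
  case/fan0E=> [bab|[def_a def_b]|[def_a def_b]].
  - exact: (clC _ _ aV bV Ca (@base_fan k _ _ bab)).
  - have fah : fan k a h by rewrite def_a fan_sym base_fan.
    apply: (clC _ _ hV bV (clC _ _ aV hV Ca fah)).
    by rewrite def_b base_fan.
  - have fah : fan k a h by rewrite def_a fan_sym base_fan.
    apply: (clC _ _ hV bV (clC _ _ aV hV Ca fah)).
    by rewrite def_b base_fan.
move=> i iV; have [ic|ci] := ltnP i c.
  by apply: C0 => //; move: iV; rewrite inV => /and3P[].
by apply: fromh => //; apply: C0; rewrite // eq_sym.
Qed.

End Fan.

(** * Exhaustive search for hamiltonian cycles *)

Fixpoint ham_from (tab : seq (seq nat)) (start m v : nat) (U : seq nat) : bool :=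
  if m is m'.+1 then
    (* A conjunction would make call-by-value evaluation explore every branch. *)
    has (fun w => if w \in U then ham_from tab start m' w (rem w U) else false)
      (nth [::] tab v)
  else start \in nth [::] tab v.

(** A refutation needs completeness of the search, so here the table must contain every edge,
    whereas [conn_checkP] needs every entry to be an edge. *)
Lemma ham_fromP (e : rel nat) (tab : seq (seq nat)) (start v : nat) (s U : seq nat) :
  (forall i j, e i j -> j \in nth [::] tab i) ->
  path e v s -> e (last v s) start -> perm_eq s U ->
  ham_from tab start (size U) v U.
Proof.
move=> tabP; elim: s v U => [|w s IHs] v U /=.
  by move=> _ ev /perm_size <-; apply: tabP.
move=> /andP[evw es] el sU.
have wU : w \in U by rewrite -(perm_mem sU) mem_head.
have sU' : perm_eq s (rem w U).
  by rewrite -(perm_cons w) (permPl sU) perm_to_rem.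
have -> : size U = (size (rem w U)).+1 by rewrite -(perm_size sU') -(perm_size sU).
by rewrite /=; apply/hasP; exists w; rewrite ?tabP // wU IHs.
Qed.

Definition nonham_cert (c h t2 : nat) (E : seq (nat * nat)) : bool :=
  (0 < c) && ~~ ham_from (adj_table c (fan c h t2 E 0)) 0 c.-1 0 (iota 1 c.-1).

Lemma nonham_certP (c h t2 : nat) (E : seq (nat * nat)) (s : seq nat) :
  base_ok c h t2 E -> nonham_cert c h t2 E -> ~ hamcycle c h t2 E 0 s.
Proof.
move=> ok /andP[c_gt0 /negP no] /hamcycle_rot /(_ (_ : 0 < c + 0)).
rewrite addn0 => /(_ c_gt0) [w [_ cw uw mw]]; apply: no.
have := @ham_fromP (fan c h t2 E 0) (adj_table c (fan c h t2 E 0)) 0 0 w (iota 1 c.-1).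
rewrite size_iota; apply.
- move=> i j fij; have := fan_lt ok fij; rewrite addn0 => /andP[ic jc].
  by rewrite mem_adj_table ic jc.
- by move: cw; rewrite /= rcons_path => /andP[].
- by move: cw; rewrite /= rcons_path => /andP[].
- apply: uniq_perm; rewrite ?iota_uniq //; first by case/andP: uw.
  move=> i; have := mw i; rewrite inE !mem_iota addn0 => mi.
  have [i0|i0] := eqVneq i 0; first by rewrite i0 /=; case/andP: uw => /negPf.
  by move: mi; rewrite (negPf i0) /= => ->; clear -i0 c_gt0; lia.
Qed.

(** * Graphs on initial segments of the naturals *)

Lemma map_preim_seq (T : Type) (S : eqType) (f : T -> S) (s : seq S) :
  (forall y, y \in s -> exists x, f x = y) -> exists t, map f t = s.
Proof.
elim: s => [|y s IHs] fs; first by exists [::].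
have [x <-] := fs y (mem_head _ _).
by have [z zs|t <-] := IHs; [apply: fs; rewrite inE zs orbT|exists (x :: t)].
Qed.

Section NatGraph.

Variables (n : nat) (e : rel nat).
Hypotheses (e_sym : symmetric e) (e_irr : irreflexive e).

Definition nat_edge : rel 'I_n := fun i j => e i j.

Lemma nat_edge_sym : symmetric nat_edge. Proof. by move=> i j; apply: e_sym. Qed.
Lemma nat_edge_irrefl : irreflexive nat_edge. Proof. by move=> i; apply: e_irr. Qed.

Definition nat_graph : sgraph := SGraph nat_edge_sym nat_edge_irrefl.

Lemma nat_graph_order : #|nat_graph| = n. Proof. exact: card_ord. Qed.

Lemma nat_graph_hamiltonian : hamiltonian nat_graph ->
  exists s : seq nat, [/\ 2 < size s, path.cycle e s, uniq s & s =i iota 0 n].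
Proof.
move=> [s [s_gt2 cs us ms]]; exists (map val s); split.
- by rewrite size_map.
- by rewrite cycle_map.
- by rewrite map_inj_uniq //; apply: val_inj.
- move=> i; rewrite mem_iota /=; apply/mapP/idP => [[j _ ->]|lt_in]; first exact: ltn_ord.
  by exists (Ordinal lt_in).
Qed.

Lemma nat_graph_traceable (v : 'I_n) (s : seq nat) :
  0 < size s -> sorted e s -> perm_eq (val v :: s) (iota 0 n) ->
  traceable (@del_vertex nat_graph v).
Proof.
move=> s_gt0 es ps.
have us : uniq (val v :: s) by rewrite (perm_uniq ps) iota_uniq.
pose f (x : @del_vertex nat_graph v) : nat := val (val x).
have [t def_s] : exists t, map f t = s.
  apply: map_preim_seq => i is_s.
  have : i \in val v :: s by rewrite inE is_s orbT.
  rewrite (perm_mem ps) mem_iota /= => lt_in.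
  have vP : Ordinal lt_in \in (~: [set v])%SET.
    by rewrite !inE; apply: contraTneq is_s => iv; case/andP: us; rewrite -iv.
  by exists (exist _ (Ordinal lt_in) vP).
case: t def_s => [|x t] def_s; first by rewrite -def_s in s_gt0.
have inj_f : injective f by move=> y z /val_inj/val_inj.
exists x, t; split.
- by move: es; rewrite -def_s /= path_map; apply: sub_path.
- by rewrite -(map_inj_uniq inj_f) def_s; case/andP: us.
- move=> y; rewrite -(mem_map inj_f) def_s.
  have : f y \in val v :: s by rewrite (perm_mem ps) mem_iota /= ltn_ord.
  rewrite inE => /orP[/eqP fy|//].
  by have := valP y; rewrite !inE -(inj_eq val_inj) /= -[val (val y)]/(f y) fy eqxx.
Qed.

Lemma nat_graph_connected (S : {set nat_graph}) (r : 'I_n) :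
  r \notin S ->
  (forall C : nat -> Prop, C r ->
     (forall i j : 'I_n, C i -> e i j -> i \notin S -> j \notin S -> C j) ->
     forall i : 'I_n, i \notin S -> C i) ->
  connected_graph (del_vertices S).
Proof.
move=> rS closedP.
have rS' : r \in (~: S)%SET by rewrite inE.
pose R : del_vertices S := exist _ r rS'.
have conn_r (x : del_vertices S) : connect (@edge _) R x.
  suff : forall y : del_vertices S, val (val y) = val (val x) -> connect (@edge _) R y by exact.
  (* Quantifying over the vertices with value [i] gives a predicate on all naturals, including those
     that are not vertices of the subgraph. *)
  apply: (closedP (fun i => forall y : del_vertices S, val (val y) = i -> connect (@edge _) R y)).
  - move=> y yr; suff -> : y = R by exact: connect0.
    by apply/val_inj/val_inj.
  - move=> i j Ci eij iS jS y yj.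
    have iS' : i \in (~: S)%SET by rewrite inE.
    have yj' : val y = j by apply: val_inj.
    apply: connect_trans (Ci (exist _ i iS') erefl) (connect1 _).
    by rewrite /= /induced_edge /= /nat_edge /= yj'.
  - by have := valP x; rewrite inE.
split; first by apply/card_gt0P; exists R.
move=> x y; apply: connect_trans (conn_r y).
by rewrite (sym_connect_sym (@edge_sym _)).
Qed.

End NatGraph.

Import Order.TTheory GRing.Theory Num.Theory.
Import numFieldNormedType.Exports.

(** * Straight-line drawings *)

Section Segments.
Local Open Scope classical_set_scope.
Local Open Scope ring_scope.
Variable R : realType.
Implicit Types p q z : R * R.

Definition seg_point p q (t : R) : R * R :=
  (p.1 + t * (q.1 - p.1), p.2 + t * (q.2 - p.2)).

Definition segment p q : set (R * R) := seg_point p q @` `[0, 1].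

Lemma segment_sym p q : segment p q = segment q p.
Proof.
have sub p' q' : segment p' q' `<=` segment q' p'.
  move=> z [t]; rewrite /= in_itv /= => /andP[t0 t1] <-; exists (1 - t).
    by rewrite /= in_itv /=; apply/andP; split; lra.
  by congr (_, _) => /=; ring.
by apply/seteqP; split.
Qed.

Lemma segment_arc p q : p <> q -> is_arc (segment p q) p q.
Proof.
move=> pq; exists (seg_point p q); split => //.
- have lin x y : continuous (fun t : R => x + t * y).
    by move=> t; apply: cvgD; [exact: cvg_cst|exact: mulrr_continuous].
  by apply: continuous_subspaceT => t; exact: (cvg_pair (lin _ _ t) (lin _ _ t)).
- move=> t u _ _ [] /addrI /eqP e1 /addrI /eqP e2.
  apply/eqP; rewrite -subr_eq0; apply/negPn/negP => tu.
  apply: pq; case: p q e1 e2 => [p1 p2] [q1 q2] /=.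
  rewrite -subr_eq0 -mulrBl mulf_eq0 (negPf tu) /= => /eqP e1.
  rewrite -subr_eq0 -mulrBl mulf_eq0 (negPf tu) /= => /eqP e2.
  by congr (_, _); lra.
- by case: p {pq} => ? ?; rewrite /seg_point !mul0r !addr0.
- by case: q {pq} => ? ?; rewrite /seg_point !mul1r /= !subrKC.
Qed.

Definition affine (a b d : R) z : R := a * z.1 + b * z.2 + d.

Lemma affine_seg a b d p q t : affine a b d (seg_point p q t) =
  (1 - t) * affine a b d p + t * affine a b d q.
Proof. by rewrite /affine /=; ring. Qed.

(** At a common point [L] is both nonpositive and nonnegative. Both terms of its convex combination
    over p' and q' then vanish, and since [L] is nonzero at one of these ends, the point is the
    other end. *)
Lemma segment_separation a b d p q p' q' z (L := affine a b d) :
  L p <= 0 -> L q <= 0 -> 0 <= L p' -> 0 <= L q' ->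
  (L p' != 0) || (L q' != 0) -> segment p q z -> segment p' q' z ->
  (L p' = 0 /\ z = p') \/ (L q' = 0 /\ z = q').
Proof.
move=> Lp Lq Lp' Lq' nz [t]; rewrite /= in_itv /= => /andP[t0 t1] <-.
move=> [u]; rewrite /= in_itv /= => /andP[u0 u1] zE.
have Lz : L (seg_point p' q' u) = (1 - t) * L p + t * L q by rewrite zE /L affine_seg.
rewrite {1}/L affine_seg -/L in Lz.
have h1 : 0 <= (1 - u) * L p' by apply: mulr_ge0 => //; lra.
have h2 : 0 <= u * L q' by exact: mulr_ge0.
have h3 : (1 - t) * L p <= 0 by apply: mulr_ge0_le0 => //; lra.
have h4 : t * L q <= 0 by exact: mulr_ge0_le0.
have /eqP e1 : (1 - u) * L p' = 0 by lra.
have /eqP e2 : u * L q' = 0 by lra.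
move: e1 e2; rewrite -zE !mulf_eq0 => /orP[/eqP u1'|/eqP Lp0] /orP[/eqP u0'|/eqP Lq0].
- by exfalso; lra.
- right; split=> //; have -> : u = 1 by lra.
  by case: (q') => ? ?; rewrite /seg_point !mul1r /= !subrKC.
- left; split=> //; rewrite u0'.
  by case: (p') => ? ?; rewrite /seg_point !mul0r /= !addr0.
- by move: nz; rewrite Lp0 Lq0 eqxx.
Qed.

End Segments.

Lemma set2_eq (T : finType) (x y x' y' : T) :
  ([set x; y] = [set x'; y'])%SET -> (x = x' /\ y = y') \/ (x = y' /\ y = x').
Proof.
move=> E.
have := set21 x y; have := set22 x y; rewrite E => /set2P[] Ey /set2P[] Ex; subst; try by auto.
- by have := set22 x' y'; rewrite -E => /set2P[]->; auto.
- by have := set21 x' y'; rewrite -E => /set2P[]->; auto.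
Qed.

Section StraightLine.
Local Open Scope classical_set_scope.
Local Open Scope ring_scope.
Variables (R : realType) (G : sgraph) (pt : G -> R * R).

(** The inequalities are weak so that edges with a common end are covered: the line may pass through
    an end of the second edge only if the first edge has that end too. *)
Definition separated (x y x' y' : G) : Prop :=
  exists a b d, let L := fun v => affine a b d (pt v) in
    [/\ L x <= 0, L y <= 0, 0 <= L x', 0 <= L y' &
        (L x' = 0 -> x' \in [set x; y]%SET) /\ (L y' = 0 -> y' \in [set x; y]%SET)].

(** Separation only speaks of pairs of edges. That an edge xy avoids every other vertex z follows by
    applying it to xy and some edge zw, since z would be a common point and hence a common end; this
    is why isolated vertices are excluded. *)
Lemma straight_line_planar :
  injective pt ->
  (forall x : G, exists y, edge x y) ->
  (forall x y x' y' : G, edge x y -> edge x' y' ->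
     [set x; y]%SET <> [set x'; y']%SET ->
     separated x y x' y' \/ separated x' y' x y) ->
  planar R G.
Proof.
move=> inj_pt no_iso sep.
pose arc (A : {set G}) : set (R * R) :=
  [set z | exists x y, A = [set x; y]%SET /\ segment (pt x) (pt y) z].
have arcE x y : arc [set x; y]%SET = segment (pt x) (pt y).
  apply/seteqP; split=> [z [x' [y' [/set2_eq[[-> ->]|[-> ->]] zs]]]|z zs]//.
    by rewrite segment_sym.
  by exists x, y.
have edge_neq (x y : G) : edge x y -> x != y.
  by move=> exy; apply: contraTneq exy => ->; rewrite edge_irrefl.
have sep_common (x y x' y' : G) z : edge x' y' -> [set x; y]%SET <> [set x'; y']%SET ->
    separated x y x' y' -> segment (pt x) (pt y) z -> segment (pt x') (pt y') z ->
    exists2 v, (v \in [set x; y] :&: [set x'; y'])%SET & pt v = z.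
  move=> e' xy [a [b [d [Lx Ly Lx' Ly' [zx' zy']]]]] s s'.
  have nz : (affine a b d (pt x') != 0) || (affine a b d (pt y') != 0).
    rewrite -negb_and; apply/negP => /andP[/eqP /zx' x'P /eqP /zy' y'P]; apply: xy.
    have := edge_neq _ _ e'; move: x'P y'P => /set2P[] -> /set2P[] ->; rewrite ?eqxx // => _.
    by rewrite finset.setUC.
  case: (segment_separation Lx Ly Lx' Ly' nz s s') => [[/zx' x'P ->]|[/zy' y'P ->]].
    by exists x'; rewrite // inE x'P set21.
  by exists y'; rewrite // inE y'P set22.
have common (x y x' y' : G) z : edge x y -> edge x' y' ->
    [set x; y]%SET <> [set x'; y']%SET ->
    segment (pt x) (pt y) z -> segment (pt x') (pt y') z ->
    exists2 v, (v \in [set x; y] :&: [set x'; y'])%SET & pt v = z.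
  move=> e e' xy s s'; case: (sep x y x' y' e e' xy) => sp.
    exact: (sep_common x y x' y').
  rewrite finset.setIC; apply: (sep_common x' y' x y) => //; exact: nesym.
exists pt, arc; split => //.
- move=> x y exy; rewrite arcE; apply: segment_arc => /inj_pt xy.
  by move: (edge_neq _ _ exy); rewrite xy eqxx.
- move=> x y z exy; rewrite arcE => zs; apply/set2P; apply: contraT => zxy.
  have [w ezw] := no_iso z.
  have xyzw : [set x; y]%SET <> [set z; w]%SET.
    by move=> E; move: zxy; have := set21 z w; rewrite -E !inE => ->.
  have zz : segment (pt z) (pt w) (pt z).
    exists 0; first by rewrite /= in_itv /= lexx ler01.
    by rewrite /seg_point !mul0r !addr0 -surjective_pairing.
  have [v] := common x y z w (pt z) exy ezw xyzw zs zz.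
  by rewrite inE => /andP[vxy _] /inj_pt vz; rewrite vz (negPf zxy) in vxy.
- move=> x y x' y' e e' xy z; rewrite !arcE => -[s s'].
  have [v vP <-] := common x y x' y' z e e' xy s s'.
  by exists v.
Qed.

End StraightLine.

(** * Drawing the fan *)

Section FanDrawing.
Local Open Scope ring_scope.

Variables (c h t2 : nat) (E : seq (nat * nat)).
Variables (pts : seq (int * int)) (seps : seq (int * int * int)).

Let P (i : nat) : int * int := nth (0, 0) pts i.

Definition line_val (l : int * int * int) (z : int * int) : int :=
  l.1.1 * z.1 + l.1.2 * z.2 + l.2.

(** The value at z is twice the signed area of the triangle p q z. *)
Definition line_through (p q : int * int) : int * int * int :=
  (p.2 - q.2, q.1 - p.1, p.1 * q.2 - p.2 * q.1).

Definition opp_line (l : int * int * int) : int * int * int :=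
  (- l.1.1, - l.1.2, - l.2).

Definition side (l : int * int * int) (e : nat * nat) (vs : seq nat) : bool :=
  [&& line_val l (P e.1) <= 0, line_val l (P e.2) <= 0
    & all (fun v => (0 <= line_val l (P v)) &&
        ((line_val l (P v) == 0) ==> (v \in [:: e.1; e.2]))) vs].

(** If no three ends are collinear, two segments that do not cross are separated by the line through
    one of them. So only the line through [e] is tried, in both orientations, and [drawing_cert]
    also calls the test with the edges swapped. *)
Definition apart (e f : nat * nat) : bool :=
  let l := line_through (P e.1) (P e.2) in
  side l e [:: f.1; f.2] || side (opp_line l) e [:: f.1; f.2].

(** The positive area orients the triangle h, t1, t2 and makes it nondegenerate. The edge t1 t2 has
    to be absent because the u_j are placed on it. *)
Definition drawing_cert : bool :=
  [&& size pts == c, uniq pts, size seps == size E,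
      0 < line_val (line_through (P h) (P c.-1)) (P t2),
      ~~ base E c.-1 t2,
      all (fun v => has (fun e => v \in [:: e.1; e.2]) E) (iota 0 c),
      all (fun e => all (fun f => [|| e == f, apart e f | apart f e]) E) E
    & all (fun es => side es.2 es.1 [:: h; c.-1; t2]) (zip E seps)].

Hypotheses (ok : base_ok c h t2 E) (cert : drawing_cert).
Variables (R : realType) (k : nat).

Let rp (i : nat) : R * R := ((P i).1%:~R, (P i).2%:~R).

Definition draw (i : nat) : R * R :=
  if (c <= i)%N then
    seg_point (rp c.-1) (rp t2) ((i - c.-1)%:R / k.+1%:R)
  else rp i.

(** A single index for the whole path: t1 at 0, u_m at m, t2 at k + 1. [draw] places these vertices
    at equal distances. *)
Let w (m : nat) : nat := if m == k.+1 then t2 else (c.-1 + m)%N.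

Let aff (l : int * int * int) : R * R -> R :=
  affine l.1.1%:~R l.1.2%:~R l.2%:~R.

Lemma affE l i : aff l (rp i) = (line_val l (P i))%:~R.
Proof. by rewrite /aff /affine /line_val !intrD !intrM. Qed.

Lemma draw_base i : (i < c)%N -> draw i = rp i.
Proof. by rewrite ltnNge /draw => /negPf ->. Qed.

Lemma c_gt0 : (0 < c)%N. Proof. have := hlt ok; clear; lia. Qed.
Lemma h_lt : (h < c)%N. Proof. have := hlt ok; clear; lia. Qed.
Lemma t1_lt : (c.-1 < c)%N. Proof. by rewrite prednK ?c_gt0. Qed.
Lemma t2_lt : (t2 < c)%N. Proof. have := t2lt ok; clear; lia. Qed.

Lemma w0 : w 0 = c.-1. Proof. by rewrite /w addn0. Qed.
Lemma wk1 : w k.+1 = t2. Proof. by rewrite /w eqxx. Qed.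

Lemma draw_w m : (m <= k.+1)%N ->
  draw (w m) = seg_point (rp c.-1) (rp t2) (m%:R / k.+1%:R).
Proof.
rewrite leq_eqVlt => /orP[/eqP ->|mk].
  rewrite wk1 draw_base ?t2_lt // divff ?pnatr_eq0 //.
  by rewrite /seg_point !mul1r !subrKC.
have -> : w m = (c.-1 + m)%N by rewrite /w (ltn_eqF mk).
case: m mk => [|m] mk.
  by rewrite addn0 draw_base ?t1_lt // mul0r /seg_point !mul0r !addr0.
rewrite /draw addKn ifT //; have := c_gt0; clear; lia.
Qed.

Lemma aff_w l m : (m <= k.+1)%N -> aff l (draw (w m)) =
  (1 - m%:R / k.+1%:R) * aff l (rp c.-1) + m%:R / k.+1%:R * aff l (rp t2).
Proof. by move=> mk; rewrite draw_w // /aff affine_seg. Qed.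

Lemma kR_gt0 : 0 < k.+1%:R :> R. Proof. by rewrite ltr0n. Qed.

Definition sepn (x y x' y' : nat) : Prop :=
  exists a b d : R, let L := fun v => affine a b d (draw v) in
    [/\ L x <= 0, L y <= 0, 0 <= L x', 0 <= L y' &
        (L x' = 0 -> x' \in [:: x; y]) /\ (L y' = 0 -> y' \in [:: x; y])].

Definition unlinked (e f : nat * nat) : Prop :=
  sepn e.1 e.2 f.1 f.2 \/ sepn f.1 f.2 e.1 e.2.

Lemma unlinked_sym e f : unlinked e f -> unlinked f e.
Proof. by case; [right|left]. Qed.

Lemma unlinked_swap x y f : unlinked (x, y) f -> unlinked (y, x) f.
Proof.
have mC (z u v : nat) : (z \in [:: u; v]) = (z \in [:: v; u]) by rewrite !inE orbC.
case=> -[a [b [d [Lx Ly Lx' Ly' [z1 z2]]]]]; [left|right]; exists a, b, d.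
  by split=> //=; split; rewrite mC.
by split.
Qed.

Lemma side_sepn l e x' y' : (e.1 < c)%N -> (e.2 < c)%N -> (x' < c)%N -> (y' < c)%N ->
  side l e [:: x'; y'] -> sepn e.1 e.2 x' y'.
Proof.
move=> e1 e2 xc yc /and3P[l1 l2 /= /and3P[/andP[lx zx] /andP[ly zy] _]].
exists l.1.1%:~R, l.1.2%:~R, l.2%:~R; rewrite /= !draw_base // -!/(aff l _) !affE.
rewrite !lerz0 !ler0z; split=> //; split=> /eqP; rewrite intr_eq0.
  by move=> z; apply: (implyP zx).
by move=> z; apply: (implyP zy).
Qed.

(** This is the line through h and the j-th point of the path. Its value at z is twice the signed
    area of h, that point and z, so along the path it grows by the constant [K / (k + 1)], with [K]
    twice the area of the triangle h t1 t2. *)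
Lemma spoke_functional (j : nat) : exists a b d delta : R, [/\ 0 < delta,
  affine a b d (draw h) = 0 &
  forall m, (m <= k.+1)%N -> affine a b d (draw (w m)) = (m%:R - j%:R) * delta].
Proof.
case/and5P: cert => _ _ _ K_gt0 _.
set K := line_val _ _ in K_gt0.
pose t : R := j%:R / k.+1%:R.
pose q := seg_point (rp c.-1) (rp t2) t.
exists ((rp h).2 - q.2), (q.1 - (rp h).1), ((rp h).1 * q.2 - (rp h).2 * q.1), (K%:~R / k.+1%:R).
split.
- by rewrite divr_gt0 ?kR_gt0 // ltr0z.
- by rewrite draw_base ?h_lt // /affine; ring.
move=> m mk; rewrite draw_w // /affine /seg_point /K /line_val /line_through /=.
rewrite !(intrD, intrM, mulrNz) /q /seg_point /t /rp /=.
have : k.+1%:R != 0 :> R by rewrite pnatr_eq0.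
by move: (k.+1%:R : R) => n1 n1_neq0; field.
Qed.

Lemma kind_edge x y : fan c h t2 E k x y -> exists e,
  (e = (x, y) \/ e = (y, x)) /\
  [\/ e \in E,
      exists2 j, (0 < j <= k)%N & e = (h, w j) |
      exists2 i, (i <= k)%N & e = (w i, w i.+1)].
Proof.
have c0 := c_gt0.
have half u v : fan_half c h t2 k u v ->
    (exists2 j, (0 < j <= k)%N & (u, v) = (h, w j)) \/
    (exists2 i, (i <= k)%N & (u, v) = (w i, w i.+1)).
  rewrite /fan_half /= => /or3P[/andP[/eqP -> /andP[cv vk]]|/and3P[cu /eqP -> uk]|/andP[/eqP -> /eqP ->]].
  - left; exists (v - c.-1)%N; first by clear -cv vk c0; lia.
    by congr (_, _); rewrite /w ifF; clear -cv vk c0; lia.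
  - right; exists (u - c.-1)%N; first by clear -cu uk; lia.
    by congr (_, _); rewrite /w ifF; clear -cu uk; lia.
  - right; exists k => //; congr (_, _); last by rewrite wk1.
    by rewrite /w ifF; clear -c0; lia.
case/orP=> [/orP[]|/orP[]] f.
- by exists (x, y); split; [left|constructor 1].
- by exists (y, x); split; [right|constructor 1].
- by exists (x, y); split; [left|case: (half _ _ f); [constructor 2|constructor 3]].
- by exists (y, x); split; [right|case: (half _ _ f); [constructor 2|constructor 3]].
Qed.

(** The certificate gives a line for the three corners of the triangle only; by convexity it serves
    for all points of the segment t1 t2, whatever k is. *)
Lemma base_edge_T (e : nat * nat) : e \in E -> exists l,
  [/\ line_val l (P e.1) <= 0, line_val l (P e.2) <= 0 &
     forall v, v = h \/ (exists2 m, (m <= k.+1)%N & v = w m) ->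
       0 <= aff l (draw v) /\ (aff l (draw v) = 0 -> v \in [:: e.1; e.2])].
Proof.
move=> eE; case/and5P: cert => _ _ /eqP sz _ /and4P[nt12 _ _ /allP sidesP].
have [i ie def_e] : exists2 i, (i < size E)%N & e = nth (0, 0)%N E i.
  by exists (index e E); rewrite ?index_mem ?nth_index.
pose l := nth ((0, 0), 0) seps i.
have zi : (nth (0, 0)%N E i, l) \in zip E seps.
  by rewrite -nth_zip // mem_nth // size_zip sz minnn.
have /and3P[l1 l2 /= /and4P[/andP[lh zh] /andP[lt1 zt1] /andP[lt2 zt2] _]] := sidesP _ zi.
rewrite -def_e in l1 l2 zh zt1 zt2.
have t1_neq_t2 : c.-1 != t2 by rewrite eq_sym neq_ltn (t2lt ok).
exists l; split=> // v [->|[m mk ->]].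
  rewrite draw_base ?h_lt // affE ler0z; split=> // /eqP; rewrite intr_eq0 => z.
  exact: (implyP zh).
have t1ge : 0 <= aff l (rp c.-1) by rewrite affE ler0z.
have t2ge : 0 <= aff l (rp t2) by rewrite affE ler0z.
have tz1 : aff l (rp c.-1) = 0 -> c.-1 \in [:: e.1; e.2].
  by move/eqP; rewrite affE intr_eq0; apply: (implyP zt1).
have tz2 : aff l (rp t2) = 0 -> t2 \in [:: e.1; e.2].
  by move/eqP; rewrite affE intr_eq0; apply: (implyP zt2).
have [->|m_gt0] := posnP m; first by rewrite w0 draw_base ?t1_lt.
move: mk; rewrite leq_eqVlt => /orP[/eqP ->|mk]; first by rewrite wk1 draw_base ?t2_lt.
rewrite aff_w ?(ltnW mk) //.
have s_gt0 : 0 < m%:R / k.+1%:R :> R by rewrite divr_gt0 ?ltr0n.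
have s_lt1 : 0 < 1 - m%:R / k.+1%:R :> R.
  by rewrite subr_gt0 ltr_pdivrMr ?ltr0n // mul1r ltr_nat.
split; first by rewrite addr_ge0 // mulr_ge0 // ltW.
(* Strictly between t1 and t2 both weights are positive, so a zero forces zeros at t1 and t2. Both
   would then be ends of [e], which is impossible as t1 t2 is not a core edge. *)
move/eqP; rewrite paddr_eq0 ?mulr_ge0 ?(ltW s_gt0) ?(ltW s_lt1) //.
rewrite mulf_eq0 (gt_eqF s_lt1) mulf_eq0 (gt_eqF s_gt0) /= => /andP[/eqP /tz1 a /eqP /tz2 b].
have bE : base E e.1 e.2 by rewrite /base /= -surjective_pairing eE.
have bE' : base E e.2 e.1 by rewrite base_sym.
exfalso; move: a b; rewrite !inE => /orP[]/eqP A /orP[]/eqP B.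
- by case/eqP: t1_neq_t2; rewrite A B.
- by move: nt12; rewrite A B bE.
- by move: nt12; rewrite A B bE'.
- by case/eqP: t1_neq_t2; rewrite A B.
Qed.

Lemma E_lt (e : nat * nat) : e \in E -> (e.1 < c)%N /\ (e.2 < c)%N.
Proof.
move=> eE; have b : base E e.1 e.2 by rewrite /base /= -surjective_pairing eE.
by have /and3P[] := base_lt ok b.
Qed.

Let onT (v : nat) : Prop := v = h \/ (exists2 m, (m <= k.+1)%N & v = w m).

Lemma base_T_sepn (e : nat * nat) x y : e \in E -> onT x -> onT y -> sepn e.1 e.2 x y.
Proof.
move=> eE Tx Ty; have [e1 e2] := E_lt eE; have [l [l1 l2 lT]] := base_edge_T eE.
exists l.1.1%:~R, l.1.2%:~R, l.2%:~R => /=.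
have [x0 xz] := lT x Tx; have [y0 yz] := lT y Ty.
by rewrite -!/(aff l _) (draw_base e1) (draw_base e2) !affE !lerz0; split.
Qed.

Lemma affineN (a b d : R) z : affine (- a) (- b) (- d) z = - affine a b d z.
Proof. by rewrite /affine; ring. Qed.

Let kind (e : nat * nat) : Prop :=
  [\/ e \in E,
      exists2 j, (0 < j <= k)%N & e = (h, w j) |
      exists2 i, (i <= k)%N & e = (w i, w i.+1)].

Lemma kind_onT e : kind e -> e \in E \/ onT e.1 /\ onT e.2.
Proof.
case=> [eE|[j /andP[_ jk] ->]|[i ik ->]]; first by left.
  by right; split; [left|right; exists j => //; apply: leqW].
by right; split; right; [exists i => //; apply: leqW|exists i.+1].
Qed.

(** Two core edges are separated by [apart], a core edge and a new edge by the line of the core edge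
    that clears the triangle, and two new edges by a line through h and a point of the path. *)
Lemma kind_unlinked e f : kind e -> kind f ->
  ~ ([:: e.1; e.2] =i [:: f.1; f.2]) -> unlinked e f.
Proof.
have natz (m j : nat) (delta : R) : 0 < delta ->
    (m%:R - j%:R) * delta = 0 -> m = j.
  move=> d0 /eqP; rewrite mulf_eq0 (gt_eqF d0) orbF subr_eq0 eqr_nat.
  by move/eqP.
have spoke_spoke i j : (0 < i <= k)%N -> (0 < j <= k)%N -> (i < j)%N ->
    unlinked (h, w i) (h, w j).
  move=> /andP[_ /leqW ik] /andP[_ /leqW jk] ij; left.
  have [a [b [d [delta [d0 Lh Lw]]]]] := spoke_functional i.
  exists a, b, d; rewrite /= Lh !Lw // subrr mul0r; split=> //.
    by rewrite mulr_ge0 ?(ltW d0) // subr_ge0 ler_nat ltnW.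
  split=> [_|/(natz _ _ _ d0) ji]; first by rewrite inE eqxx.
  by rewrite ji ltnn in ij.
have spoke_path i j : (0 < j <= k)%N -> (i <= k)%N ->
    unlinked (h, w j) (w i, w i.+1).
  move=> /andP[_ /leqW jk] ik; have ik1 := leqW ik; have ik2 : (i.+1 <= k.+1)%N := ik; left.
  have [a [b [d [delta [d0 Lh Lw]]]]] := spoke_functional j.
  have [ji|ij] := leqP j i.
    exists a, b, d; rewrite /= Lh !Lw // subrr mul0r; split=> //.
    - by rewrite mulr_ge0 ?(ltW d0) // subr_ge0 ler_nat.
    - by rewrite mulr_ge0 ?(ltW d0) // subr_ge0 ler_nat leqW.
    - by split=> /(natz _ _ _ d0) ->; rewrite !inE eqxx orbT.
  exists (- a), (- b), (- d); rewrite /= !affineN Lh !Lw // subrr mul0r oppr0.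
  split=> //.
  - by rewrite -mulNr opprB mulr_ge0 ?(ltW d0) // subr_ge0 ler_nat ltnW.
  - by rewrite -mulNr opprB mulr_ge0 ?(ltW d0) // subr_ge0 ler_nat.
  - by split=> /eqP; rewrite oppr_eq0 => /eqP /(natz _ _ _ d0) ->; rewrite !inE eqxx orbT.
(* Path edges are collinear, so a line across the path is needed: the one through h and the later
   end of the first edge. *)
have path_path i j : (i <= k)%N -> (j <= k)%N -> (i < j)%N ->
    unlinked (w i, w i.+1) (w j, w j.+1).
  move=> ik jk ij; have ik1 := leqW ik; have ik2 : (i.+1 <= k.+1)%N := ik.
  have jk1 := leqW jk; have jk2 : (j.+1 <= k.+1)%N := jk; left.
  have [a [b [d [delta [d0 Lh Lw]]]]] := spoke_functional i.+1.
  exists a, b, d; rewrite /= !Lw // subrr mul0r; split=> //.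
  - by rewrite mulr_le0_ge0 ?(ltW d0) // subr_le0 ler_nat.
  - by rewrite mulr_ge0 ?(ltW d0) // subr_ge0 ler_nat.
  - by rewrite mulr_ge0 ?(ltW d0) // subr_ge0 ler_nat ltnW.
  - by split=> /(natz _ _ _ d0) ->; rewrite !inE eqxx orbT.
move=> ke kf ef.
case: (kind_onT ke) (kind_onT kf) => [eE|[Te1 Te2]] [fE|[Tf1 Tf2]].
- have [e1 e2] := E_lt eE; have [f1 f2] := E_lt fE.
  case/and5P: cert => _ _ _ _ /and4P[_ _ /allP ap _].
  have apartP := allP (ap e eE) f fE.
  case/or3P: apartP => [/eqP efE|/orP[] sd|/orP[] sd].
  + by case: ef; rewrite efE.
  + by left; apply: side_sepn sd.
  + by left; apply: side_sepn sd.
  + by right; apply: side_sepn sd.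
  + by right; apply: side_sepn sd.
- by left; apply: base_T_sepn.
- by right; apply: base_T_sepn.
case: ke ef {Te1 Te2} => [eE|[i ik ->]|[i ik ->]] ef.
- by left; apply: base_T_sepn.
- case: kf ef {Tf1 Tf2} => [fE|[j jk ->]|[j jk ->]] ef.
  + right; apply: base_T_sepn => //; first by left.
    by right; exists i => //; case/andP: ik => _ /leqW.
  + by case: (ltngtP i j) => ij; [exact: spoke_spoke|apply: unlinked_sym; exact: spoke_spoke|case: ef; rewrite ij].
  + exact: spoke_path.
- case: kf ef {Tf1 Tf2} => [fE|[j jk ->]|[j jk ->]] ef.
  + by right; apply: base_T_sepn => //; right; [exists i => //; apply: leqW|exists i.+1].
  + by apply: unlinked_sym; apply: spoke_path.
  + by case: (ltngtP i j) => ij; [exact: path_path|apply: unlinked_sym; exact: path_path|case: ef; rewrite ij].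
Qed.

Lemma draw_inj x y : (x < c + k)%N -> (y < c + k)%N -> draw x = draw y -> x = y.
Proof.
have c0 := c_gt0.
have wE v : (c <= v)%N -> (v < c + k)%N -> v = w (v - c.-1) /\ (v - c.-1 <= k.+1)%N.
  move=> cv vk; have vk' : (v - c.-1 < k.+1)%N by clear -cv vk c0; lia.
  by rewrite /w (ltn_eqF vk') ltnW //; split=> //; clear -cv; lia.
case/and5P: cert => /eqP szp up _ _ /and4P[_ /allP inc _ _].
(* The line of a core edge at [u] is nonpositive at [u] and nonnegative at [v]. If the points agree
   it vanishes there, which makes [v] an end of a core edge, against [c <= v]. *)
have mixed u v : (u < c)%N -> (c <= v)%N -> (v < c + k)%N -> draw u = draw v -> u = v.
  move=> uc cv vk uv; have := inc u; rewrite mem_iota add0n => /(_ uc) /hasP[e eE ue].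
  have [l [l1 l2 lT]] := base_edge_T eE.
  have [vw vk1] := wE v cv vk; have [|lv lz] := lT v; first by right; exists (v - c.-1)%N.
  have lu : aff l (draw u) <= 0.
    by rewrite draw_base // affE lerz0; move: ue; rewrite !inE => /orP[]/eqP ->.
  have lv0 : aff l (draw v) = 0 by apply/le_anti; rewrite lv -uv lu.
  have [e1 e2] := E_lt eE.
  by move: (lz lv0) e1 e2 cv; rewrite !inE => /orP[]/eqP <-; clear; lia.
move=> xk yk xy; have [xc|cx] := ltnP x c; have [yc|cy] := ltnP y c.
- have inj_int : injective (fun z : int => z%:~R : R) by exact: intr_inj.
  move: xy; rewrite !draw_base // => -[/inj_int a /inj_int b].
  have : P x = P y by rewrite [P x]surjective_pairing [P y]surjective_pairing a b.
  by move/eqP; rewrite nth_uniq ?szp // => /eqP.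
- exact: mixed.
- by apply/esym/mixed.
(* The functional of the line h t1 takes distinct values along the path. *)
have [a [b [d [delta [d0 _ Lw]]]]] := spoke_functional 0.
have [xw xk1] := wE x cx xk; have [yw yk1] := wE y cy yk.
have : affine a b d (draw x) = affine a b d (draw y) by rewrite xy.
rewrite xw yw !Lw // => /(mulIf (lt0r_neq0 d0)) /addIr /eqP.
by rewrite eqr_nat => /eqP ->.
Qed.

Lemma fan_planar :
  planar R (nat_graph (c + k) (fan_sym c h t2 E k) (fan_irrefl ok k)).
Proof.
have set2E (x y u v : 'I_(c + k)) :
    [:: val x; val y] =i [:: val u; val v] -> ([set x; y] = [set u; v])%SET.
  by move=> xy; apply/setP => z; have := xy (val z); rewrite !inE !(inj_eq val_inj).
apply: (@straight_line_planar R (nat_graph (c + k) (fan_sym c h t2 E k) (fan_irrefl ok k)) (fun i : 'I_(c + k) => draw i)).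
- by move=> x y /draw_inj xy; apply/val_inj/xy.
- move=> x; have [xc|cx] := ltnP x c.
    case/and5P: cert => _ _ _ _ /and4P[_ /allP/(_ (val x)) inc _ _].
    move: inc; rewrite mem_iota add0n => /(_ xc) /hasP[e eE xe].
    have [e1 e2] := E_lt eE.
    have [u uc bu] : exists2 u, (u < c)%N & base E x u.
      move: xe; rewrite !inE => /orP[]/eqP ->; [exists e.2|exists e.1] => //;
        by rewrite /base /= -surjective_pairing eE ?orbT.
    exists (Ordinal (leq_trans uc (leq_addr k c))).
    by rewrite /= /nat_edge /= /fan /= bu.
  have hk : (h < c + k)%N by apply: leq_trans h_lt (leq_addr _ _).
  exists (Ordinal hk); rewrite /= /nat_edge fan_sym; apply: fan_h => //.
  by rewrite cx ltn_ord.
move=> x y x' y' /(@kind_edge x y)[e [exy ke]] /(@kind_edge x' y')[f [fxy kf]] xy.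
have sep2 : unlinked (val x, val y) (val x', val y').
  have ef : ~ ([:: e.1; e.2] =i [:: f.1; f.2]).
    have same (u : nat * nat) a b : u = (a, b) \/ u = (b, a) -> [:: u.1; u.2] =i [:: a; b].
      by case=> -> z //; rewrite !inE orbC.
    by move=> ef; apply/xy/set2E => z; rewrite -(same _ _ _ exy) ef (same _ _ _ fxy).
  have u := kind_unlinked ke kf ef.
  case: exy u => -> u; case: fxy u => -> u //.
  - by apply: unlinked_sym; apply: unlinked_swap; apply: unlinked_sym.
  - exact: unlinked_swap.
  - apply: unlinked_swap; apply: unlinked_sym; apply: unlinked_swap.
    exact: unlinked_sym.
have mem2 (z u v : 'I_(c + k)) : (val z \in [:: val u; val v]) -> z \in [set u; v]%SET.
  by rewrite !inE !(inj_eq val_inj).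
case: sep2 => -[a [b [d [L1 L2 L3 L4 [z1 z2]]]]]; [left|right]; exists a, b, d.
  by split=> //; split=> [/z1|/z2]; apply: mem2.
by split=> //; split=> [/z1|/z2]; apply: mem2.
Qed.

End FanDrawing.

(** * The core on 21 vertices *)

(* The edge 20 -- 1 opposite to h = 0 is left to the fan with k = 0. *)
Definition core_edges : seq (nat * nat) :=
  [:: (0, 1); (0, 16); (0, 20); (1, 2); (1, 14); (1, 19); (2, 8); (2, 12);
      (3, 5); (3, 14); (3, 19); (4, 9); (4, 15); (4, 16); (5, 7); (5, 10);
      (6, 11); (6, 13); (6, 20); (7, 19); (7, 20); (8, 16); (8, 18);
      (9, 11); (9, 13); (10, 12); (10, 14); (10, 17); (11, 16); (12, 18);
      (13, 15); (15, 17); (15, 18); (17, 20)].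

Definition core_points : seq (int * int) :=
  ([:: (4, 11); (12, 0); (4, - 11); (6, 0); (- 6, 4); (5, 0); (- 1, 5);
      (6, 3); (- 10, - 7); (- 6, 5); (3, - 1); (- 7, 6); (1, - 3); (- 2, 4);
      (6, - 1); (- 3, 0); (- 10, 7); (2, 2); (- 3, - 3); (9, 1); (4, 6)])%R.

(* Separating lines (a, b, d), read a x + b y + d = 0, in the order of
   core_edges: the edge lies on the nonpositive side, the triangle 0, 1, 20 on
   the nonnegative one. *)
Definition core_lines : seq (int * int * int) :=
  ([:: (- 11, - 8, 132); (1, - 1, 7); (1, 0, - 4); (0, 1, 0); (0, 1, 0);
      (1, 2, - 12); (0, 1, 7); (0, 1, 3); (1, 1, - 6); (1, 1, - 6);
      (1, 2, - 11); (1, 0, 6); (1, 0, 3); (1, 0, 6); (1, 1, - 9);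
      (1, 1, - 5); (1, 0, 1); (1, 0, 1); (1, 1, - 10); (2, 3, - 21);
      (1, 1, - 10); (1, 0, 10); (0, 1, 3); (1, 0, 6); (1, 0, 2); (0, 1, 1);
      (0, 1, 1); (1, 0, - 3); (1, 0, 7); (0, 1, 3); (1, 0, 2); (1, 0, - 2);
      (1, 0, 3); (1, 1, - 10)])%R.

(* Entry v is (s1, s2): for each k, the path s1, u_1, ..., u_k, s2 is
   hamiltonian in the fan minus v. *)
Definition core_traces : seq (seq nat * seq nat) :=
  [:: ([::], [:: 1; 2; 12; 18; 8; 16; 4; 9; 11; 6; 13; 15; 17; 20; 7; 19; 3;
   5; 10; 14]); ([:: 19; 7; 5; 3; 14; 10; 17; 20], [:: 0; 16; 8; 2; 12; 18;
   15; 13; 6; 11; 9; 4]); ([::], [:: 0; 1; 14; 3; 19; 7; 5; 10; 12; 18; 8;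
   16; 4; 9; 11; 6; 13; 15; 17; 20]); ([::], [:: 0; 20; 17; 15; 4; 9; 13; 6;
   11; 16; 8; 18; 12; 2; 1; 14; 10; 5; 7; 19]); ([::], [:: 0; 16; 8; 2; 12;
   18; 15; 13; 9; 11; 6; 20; 17; 10; 5; 7; 19; 1; 14; 3]); ([::], [:: 0; 16;
   4; 9; 11; 6; 13; 15; 17; 10; 12; 18; 8; 2; 1; 14; 3; 19; 7; 20]); ([::],
   [:: 0; 20; 17; 10; 5; 7; 19; 3; 14; 1; 2; 12; 18; 8; 16; 11; 9; 4; 15;
   13]); ([::], [:: 0; 20; 17; 15; 4; 9; 13; 6; 11; 16; 8; 18; 12; 2; 1; 19;
   3; 5; 10; 14]); ([::], [:: 0; 16; 4; 9; 11; 6; 13; 15; 18; 12; 2; 1; 14;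
   3; 19; 7; 5; 10; 17; 20]); ([::], [:: 0; 20; 17; 10; 5; 7; 19; 3; 14; 1;
   2; 12; 18; 8; 16; 4; 15; 13; 6; 11]); ([::], [:: 0; 20; 17; 15; 4; 9; 13;
   6; 11; 16; 8; 18; 12; 2; 1; 14; 3; 5; 7; 19]); ([::], [:: 0; 16; 4; 9;
   13; 6; 20; 7; 5; 3; 19; 1; 14; 10; 17; 15; 18; 8; 2; 12]); ([::], [:: 0;
   16; 4; 9; 11; 6; 13; 15; 18; 8; 2; 1; 14; 3; 19; 7; 5; 10; 17; 20]);
   ([::], [:: 0; 16; 4; 9; 11; 6; 20; 7; 5; 3; 19; 1; 14; 10; 17; 15; 18; 8;
   2; 12]); ([::], [:: 0; 1; 2; 8; 16; 4; 9; 11; 6; 13; 15; 18; 12; 10; 17;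
   20; 7; 5; 3; 19]); ([::], [:: 0; 20; 17; 10; 5; 7; 19; 3; 14; 1; 2; 12;
   18; 8; 16; 4; 9; 11; 6; 13]); ([:: 13; 6; 11; 9; 4; 15; 17; 20], [:: 0;
   1; 14; 3; 19; 7; 5; 10; 12; 18; 8; 2]); ([::], [:: 0; 16; 4; 9; 11; 6;
   13; 15; 18; 8; 2; 12; 10; 5; 3; 14; 1; 19; 7; 20]); ([::], [:: 0; 16; 8;
   2; 12; 10; 5; 3; 14; 1; 19; 7; 20; 17; 15; 4; 9; 11; 6; 13]); ([::], [::
   0; 1; 2; 8; 16; 4; 9; 11; 6; 13; 15; 18; 12; 10; 14; 3; 5; 7; 20; 17]);
   ([::], [:: 0; 1; 2; 12; 18; 8; 16; 4; 9; 11; 6; 13; 15; 17; 10; 14; 3; 5;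
   7; 19])].

(* s1, 0, s2 is a hamiltonian path of the core through 20, 0, 1. *)
Definition core_fan_trace : seq nat * seq nat :=
  ([:: 2; 8; 16; 4; 9; 11; 6; 13; 15; 18; 12; 10; 17; 20],
   [:: 1; 14; 3; 5; 7; 19]).

Lemma core_ok : base_ok 21 0 1 core_edges.
Proof. by vm_compute. Qed.

Lemma core_nonham : nonham_cert 21 0 1 core_edges.
Proof. by vm_compute. Qed.

Lemma core_connected : conn_cert 21 0 1 core_edges.
Proof. by vm_compute. Qed.

Lemma core_drawing : drawing_cert 21 0 1 core_edges core_points core_lines.
Proof. by vm_compute. Qed.

Lemma core_traceable : all (fun v => trace_cert 21 0 1 core_edges v
  (nth ([::], [::]) core_traces v).1 (nth ([::], [::]) core_traces v).2) (iota 0 21).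
Proof. by vm_compute. Qed.

Lemma core_fan_traceable :
  let: (s1, s2) := core_fan_trace in
  [&& perm_eq (0 :: s1 ++ s2) (iota 0 21), sorted (base core_edges) s1,
      sorted (base core_edges) s2,
      (~~ nilp s1) && (last 0 s1 == 20) & (~~ nilp s2) && (head 0 s2 == 1)].
Proof. by vm_compute. Qed.

Definition core_fan (k : nat) : sgraph :=
  nat_graph (21 + k) (fan_sym 21 0 1 core_edges k) (fan_irrefl core_ok k).

Lemma set_card_lt3 (n : nat) (S : {set 'I_n}) : #|S| < 3 ->
  exists x y : nat, forall i : 'I_n, (i \in S) = (val i \in [:: x; y]).
Proof.
case card_S: #|S| => [|[|[|//]]] _.
- exists n, n => i; rewrite (cards0_eq card_S) !inE orbb.
  by rewrite (ltn_eqF (ltn_ord i)).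
- have /eqP/cards1P[x ->] := card_S.
  by exists x, x => i; rewrite !inE orbb.
- have /eqP/cards2P[x [y [_ ->]]] := card_S.
  by exists x, y => i; rewrite !inE.
Qed.

Lemma core_fan_3connected (k : nat) : k_connected 3 (core_fan k).
Proof.
split=> [|S /set_card_lt3 [x [y Sxy]]]; first by rewrite nat_graph_order.
have [r] := @fan_conn 21 0 1 core_edges core_ok k x y core_connected.
rewrite mem_filter mem_iota add0n => /andP[rxy rn] connP.
have memV (i : 'I_(21 + k)) : i \notin S ->
    val i \in [seq i <- iota 0 (21 + k) | i \notin [:: x; y]].
  by rewrite mem_filter mem_iota add0n /= ltn_ord andbT Sxy.
apply: (@nat_graph_connected _ _ _ _ S (Ordinal rn)); first by rewrite Sxy.
move=> C Cr clC i iS; apply: (connP C Cr) (memV _ iS).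
move=> a b; rewrite !mem_filter !mem_iota !add0n => /andP[aS an] /andP[bS bn] Ca ab.
have := clC (Ordinal an) (Ordinal bn) Ca ab; apply; by rewrite Sxy.
Qed.

Lemma core_fan_platypus (k : nat) : platypus (core_fan k).
Proof.
split; first by rewrite nat_graph_order.
  case/nat_graph_hamiltonian => s [s2 cs us ms].
  have [|s'] := @hamcycle_contract 21 0 1 core_edges core_ok k s; first by split.
  exact: nonham_certP core_ok core_nonham.
move=> v; have long s : perm_eq (val v :: s) (iota 0 (21 + k)) -> 0 < size s.
  by move/perm_size; rewrite /= size_iota => -[->].
have [vc|cv] := ltnP v 21.
  have vI : val v \in iota 0 21 by rewrite mem_iota.
  have [path_s perm_s] := trace_base core_ok k (allP core_traceable _ vI).
  exact: nat_graph_traceable (long _ perm_s) path_s perm_s.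
have vk : v - 21 < k by rewrite ltn_subLR.
have := core_fan_traceable; case: core_fan_trace => s1 s2 cert.
have [path_s] := trace_fan core_ok vk cert; rewrite subnKC // => perm_s.
exact: nat_graph_traceable (long _ perm_s) path_s perm_s.
Qed.

Lemma core_fan_planar (R : realType) (k : nat) : planar R (core_fan k).
Proof.
exact: (@fan_planar 21 0 1 core_edges core_points core_lines core_ok core_drawing R k).
Qed.

Theorem theorem18 (R : realType) (n : nat) (hn : (21 <= n)%N) :
  exists G : sgraph, [/\ #|G| = n, polyhedral R G & platypus G].
Proof.
exists (core_fan (n - 21)); split.
- by rewrite nat_graph_order subnKC.
- split; last exact: core_fan_3connected.
  exact: core_fan_planar.
- exact: core_fan_platypus.
Qed.
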